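(* Assume that $\frac{f}{\varphi}\in L^1(\nu)$ for all $f\in Z$. Then the operator $(D^{e-1},Z^{e-1})$ is closable as an operator $L^2(\varphi\nu;\mathbb{H})\supset Z^{e-1}\to L^2(\varphi\nu)\ominus\mathbf{1}$.
   Context: Let $d\in\mathbb{N}$, $\Omega:=\{\gamma\in C([0,1];\mathbb{R}^d):\gamma(0)=0\}$, and let $\nu$ be the Wiener measure on $\Omega$. Let $\mathbb{H}$ be the Cameron--Martin space of absolutely continuous $f:[0,1]\to\mathbb{R}^d$ with $f(0)=0$ and $f'\in L^2([0,1];\mathbb{R}^d)$, with inner product $\langle f,g\rangle_{\mathbb{H}}=\int_0^1\langle f'(x),g'(x)\rangle_{\mathbb{R}^d}\,dx$. The weight $\varphi:\Omega\to[0,\infty]$ is measurable with $\varphi\in L^1(\nu)$ (standing assumption), and $\varphi\nu$ denotes the measure with density $\varphi$ with respect to $\nu$. Let $Z$ be the set of cylindrical functions $F(\gamma)=f(\gamma(s_1),\dots,\gamma(s_k))$, $k\in\mathbb{N}$, $0<s_1<\dots<s_k=1$, $f\in C_p^\infty((\mathbb{R}^d)^k)$ (smooth, with $f$ and all partial derivatives of polynomial growth). For such $F$, $D_sF(\gamma)=\sum_{i=1}^k (s_i\wedge s)(\nabla_{s_i}f)(\gamma(s_1),\dots,\gamma(s_k))$, $s\in[0,1]$, with $\nabla_{s_i}f$ the gradient in the $i$th variable. Let $\mathbf{1}$ be the constant function $1$ on $\Omega$. For $x\in L^2(\varphi\nu)$ put $\mathbf{x}(x):=\{x+c\mathbf{1}:c\in\mathbb{R}\}$,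 and $L^2(\varphi\nu)\ominus\mathbf{1}:=\{\mathbf{x}(x):x\in L^2(\varphi\nu)\}$. Each class $\mathbf{x}$ has a unique representative $x_0(\mathbf{x})$ with $\int x_0(\mathbf{x})\,\varphi\,d\nu=0$, and $L^2(\varphi\nu)\ominus\mathbf{1}$ is a Hilbert space with inner product $\langle\mathbf{x}_1,\mathbf{x}_2\rangle:=\langle x_0(\mathbf{x}_1),x_0(\mathbf{x}_2)\rangle_{L^2(\varphi\nu)}$. Let $Z^e:=\{\mathbf{x}(x):x\in Z\}$ and $D^e\mathbf{x}(x):=Dx$ for $x\in Z$. The operator $D^e$ is invertible on $Z^e$; its inverse is denoted $D^{e-1}$, with domain $Z^{e-1}:=\{D^e\mathbf{x}:\mathbf{x}\in Z^e\}$. *)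

(* Defs.v *)
From HB Require Import structures.
From mathcomp Require Import all_boot all_order all_algebra.
From mathcomp Require Import all_classical all_reals all_analysis.
Set Implicit Arguments.
Unset Strict Implicit.
Unset Printing Implicit Defensive.
Import Order.TTheory GRing.Theory Num.Theory.
Import numFieldNormedType.Exports.
Local Open Scope classical_set_scope.
Local Open Scope ring_scope.

(* A path is a continuous map from [0,1] to R^d starting at 0.  It is encoded as
   a total function that vanishes outside [0,1], so that two paths are equal as
   soon as they agree on [0,1]. *)
Record wiener_path (R : realType) (d : nat) := WienerPath {
  path_fun : R -> 'rV[R]_d;
  path_continuous : {within `[0, 1], continuous path_fun};
  path_start : path_fun 0 = 0;
  path_out : forall t, ~~ (0 <= t <= 1) -> path_fun t = 0 }.

Lemma zero_path_continuous (R : realType) (d : nat) :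
  {within `[0, 1], continuous (fun _ : R => 0 : 'rV[R]_d)}.
Proof. by apply: continuous_subspaceT => x; exact: cvg_cst. Qed.

Definition zero_path (R : realType) (d : nat) : wiener_path R d :=
  @WienerPath R d (fun _ => 0) (@zero_path_continuous R d) erefl (fun _ _ => erefl).

HB.instance Definition _ (R : realType) (d : nat) := gen_eqMixin (wiener_path R d).
HB.instance Definition _ (R : realType) (d : nat) := gen_choiceMixin (wiener_path R d).
HB.instance Definition _ (R : realType) (d : nat) :=
  isPointed.Build (wiener_path R d) (zero_path R d).

(* The sigma-algebra generated by the coordinate maps; it is the Borel
   sigma-algebra of the topology of uniform convergence. *)
Definition coordinate_sets (R : realType) (d : nat) : set (set (wiener_path R d)) :=
  [set A | exists (t : R) (j : 'I_d) (B : set R),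
    [/\ 0 <= t <= 1, measurable B & A = [set g | B (path_fun g t 0 j)]]].

Definition Omega (R : realType) (d : nat) :=
  g_sigma_algebraType (@coordinate_sets R d).

Definition at_time (R : realType) (d : nat) (g : Omega R d) (t : R) : 'rV[R]_d :=
  path_fun g t.

(* The coordinate process is a standard d-dimensional Brownian motion under nu:
   the coordinates of the increments over disjoint intervals are independent,
   and centred normal with variance the length of the interval.  (The second
   argument of normal_prob is the standard deviation.)  This characterizes the
   Wiener measure. *)
Definition is_wiener (R : realType) (d : nat)
    (nu : probability (Omega R d) R) : Prop :=
  forall (n : nat) (t : nat -> R) (B : 'I_n -> 'I_d -> set R),
    0 <= t 0%N -> (forall i, (i < n)%N -> t i < t i.+1) -> t n <= 1 ->
    (forall i j, measurable (B i j)) ->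
    nu [set g | forall i j, B i j (at_time g (t i.+1) 0 j - at_time g (t i) 0 j)]
    = (\prod_(i < n) \prod_(j < d)
         normal_prob 0 (Num.sqrt (t i.+1 - t i)) (B i j))%E.

Section Weight.
Context {R : realType} {d : nat} (nu : probability (Omega R d) R).
Context (phi : Omega R d -> \bar R).

Definition weighted (phi0 : forall g, (0 <= phi g)%E)
    (iphi : nu.-integrable setT phi) (A : set (Omega R d)) : \bar R :=
  (\int[nu]_(g in A) phi g)%E.

Hypothesis phi0 : forall g, (0 <= phi g)%E.
Hypothesis iphi : nu.-integrable setT phi.

Let weighted_set0 : weighted phi0 iphi set0 = 0%E.
Proof. by rewrite /weighted integral_set0. Qed.

Let weighted_ge0 A : (0 <= weighted phi0 iphi A)%E.
Proof. by apply: integral_ge0 => g _; exact: phi0. Qed.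

Let weighted_sigma_additive : semi_sigma_additive (weighted phi0 iphi).
Proof.
move=> A mA tA mUA; rewrite /weighted integral_bigcup//=; last first.
  exact: (integrableS _ _ (@subsetT _ _)).
apply: is_cvg_ereal_nneg_natsum_cond => n _ _.
by apply: integral_ge0 => g _; exact: phi0.
Qed.

HB.instance Definition _ := isMeasure.Build _ _ _ (weighted phi0 iphi)
  weighted_set0 weighted_ge0 weighted_sigma_additive.

End Weight.

(* The measure "phi nu" with density phi with respect to nu. *)
Definition weighted_measure (R : realType) (d : nat)
    (nu : probability (Omega R d) R) (phi : Omega R d -> \bar R)
    (phi0 : forall g, (0 <= phi g)%E) (iphi : nu.-integrable setT phi) :
    {measure set (Omega R d) -> \bar R} := weighted phi0 iphi.

Section CylinderFunctions.
Context {R : realType} {d : nat}.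

(* (R^d)^k is 'M[R]_(k, d): row i is the i-th variable. *)

Definition pderiv k (l : seq ('I_k * 'I_d)) (f : 'M[R]_(k, d) -> R) :
    'M[R]_(k, d) -> R :=
  foldr (fun ij g => fun x => 'D_(delta_mx ij.1 ij.2) g x) f l.

Definition poly_growth k (f : 'M[R]_(k, d) -> R) : Prop :=
  exists (C : R) (m : nat), forall x, `|f x| <= C * (1 + `|x|) ^+ m.

Definition Cp_infty k (f : 'M[R]_(k, d) -> R) : Prop :=
  forall l : seq ('I_k * 'I_d),
    [/\ forall (i : 'I_k) (j : 'I_d) x, derivable (pderiv l f) x (delta_mx i j),
        continuous (pderiv l f) & poly_growth (pderiv l f)].

Definition time_points k (s : 'I_k.+1 -> R) : Prop :=
  [/\ 0 < s ord0, forall i j : 'I_k.+1, (i < j)%N -> s i < s j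
    & s ord_max = 1].

Definition eval_at k (s : 'I_k -> R) (g : Omega R d) : 'M[R]_(k, d) :=
  \matrix_(i < k, j < d) at_time g (s i) 0 j.

Definition grad k (i : 'I_k) (f : 'M[R]_(k, d) -> R) (x : 'M[R]_(k, d)) :
    'rV[R]_d :=
  \row_(j < d) 'D_(delta_mx i j) f x.

Definition cyl k (s : 'I_k -> R) (f : 'M[R]_(k, d) -> R) : Omega R d -> R :=
  fun g => f (eval_at s g).

Definition cylD k (s : 'I_k -> R) (f : 'M[R]_(k, d) -> R) :
    Omega R d -> R -> 'rV[R]_d :=
  fun g r => \sum_(i < k) Num.min (s i) r *: grad i f (eval_at s g).

Definition cylfuns : set (Omega R d -> R) :=
  [set F | exists (k : nat) (s : 'I_k.+1 -> R) (f : 'M[R]_(k.+1, d) -> R),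
    [/\ time_points s, Cp_infty f & F = cyl s f]].

(* The graph of the operator D on the cylindrical functions. *)
Definition malliavin : set ((Omega R d -> R) * (Omega R d -> R -> 'rV[R]_d)) :=
  [set FU | exists (k : nat) (s : 'I_k.+1 -> R) (f : 'M[R]_(k.+1, d) -> R),
    [/\ time_points s, Cp_infty f, FU.1 = cyl s f & FU.2 = cylD s f]].

End CylinderFunctions.

Section CameronMartin.
Context {R : realType} {d : nat}.

Definition dotv (x y : 'rV[R]_d) : R := \sum_(j < d) x 0 j * y 0 j.

Definition abs_continuous01 (f : R -> 'rV[R]_d) : Prop :=
  forall e : R, 0 < e -> exists2 del : R, 0 < del &
    forall (n : nat) (a b : 'I_n -> R),
      (forall i, [/\ 0 <= a i, a i <= b i & b i <= 1]) ->
      (forall i j, i != j -> b i <= a j \/ b j <= a i) ->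
      \sum_(i < n) (b i - a i) < del ->
      \sum_(i < n) `|f (b i) - f (a i)| < e.

(* The elements are total functions of which only the values on [0,1] matter; the
   values of the derivative at 0 and 1 are irrelevant to the integrals. *)
Definition cameron_martin : set (R -> 'rV[R]_d) :=
  [set f | [/\ abs_continuous01 f, f 0 = 0
    & forall j : 'I_d,
        measurable_fun (`[0, 1] : set R) (fun x : R => derive1 f x 0 j) /\
        (\int[lebesgue_measure]_(x in `[0%R, 1%R]) ((derive1 f x 0 j) ^+ 2)%:E
           < +oo)%E]].

Definition innerH (f g : R -> 'rV[R]_d) : R :=
  \int[lebesgue_measure]_(x in `[0, 1]) dotv (derive1 f x) (derive1 g x).

End CameronMartin.

Section Spaces.
Context {R : realType} {d : nat} (mu : {measure set (Omega R d) -> \bar R}).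

(* Square-integrable maps into the Cameron--Martin space.  As this space is
   separable, measurability of all the pairings is strong measurability. *)
Definition L2H : set (Omega R d -> R -> 'rV[R]_d) :=
  [set u | [/\ forall g, cameron_martin (u g),
      forall h, cameron_martin h -> measurable_fun setT (fun g => innerH (u g) h)
    & (\int[mu]_g (innerH (u g) (u g))%:E < +oo)%E]].

Definition normL2H (u : Omega R d -> R -> 'rV[R]_d) : R :=
  Num.sqrt (\int[mu]_g innerH (u g) (u g)).

Definition innerL2 (x y : Omega R d -> R) : R := \int[mu]_g (x g * y g).

(* The class { x + c 1 : c in R }, where elements of L2 are taken up to
   mu-almost everywhere equality. *)
Definition cls (x : Omega R d -> R) : set (Omega R d -> R) :=
  [set y | y \in Lfun mu 2%:E /\
           exists c : R, {ae mu, forall g, y g = x g + c}].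

Definition L2e : set (set (Omega R d -> R)) :=
  [set X | exists2 x, x \in Lfun mu 2%:E & X = cls x].

Definition zero_mean_repr (X : set (Omega R d -> R)) : Omega R d -> R :=
  xget (cst 0) [set y | X y /\ (\int[mu]_g (y g)%:E = 0)%E].

Definition innerE (X Y : set (Omega R d -> R)) : R :=
  innerL2 (zero_mean_repr X) (zero_mean_repr Y).

Definition normE (X : set (Omega R d -> R)) : R := Num.sqrt (innerE X X).

Definition subE (X Y : set (Omega R d -> R)) : set (Omega R d -> R) :=
  [set z | exists x y, [/\ X x, Y y & z = (fun g => x g - y g)]].

(* The graph of D^e.  Its domain Z^e has to lie in L2e and its range in L2H,
   hence the two membership conditions; they hold for every cylindrical function
   when all the coordinates have moments of all orders under mu. *)
Definition De : set (set (Omega R d -> R) * (Omega R d -> R -> 'rV[R]_d)) :=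
  [set XU | exists F : Omega R d -> R,
    [/\ malliavin (F, XU.2), F \in Lfun mu 2%:E, L2H XU.2 & XU.1 = cls F]].

Definition De_inv : set ((Omega R d -> R -> 'rV[R]_d) * set (Omega R d -> R)) :=
  [set UX | De (UX.2, UX.1)].

(* An operator from L2H to L2e, given by its graph G, is closable if the only
   element Y for which (0, Y) is in the closure of G is Y = 0; the zero vector
   of L2e is the class of the constant functions. *)
Definition closable
    (G : set ((Omega R d -> R -> 'rV[R]_d) * set (Omega R d -> R))) : Prop :=
  forall (u : nat -> Omega R d -> R -> 'rV[R]_d)
         (X : nat -> set (Omega R d -> R)) (Y : set (Omega R d -> R)),
    (forall n, G (u n, X n)) -> L2e Y ->
    (fun n => normL2H (u n)) @ \oo --> (0 : R) ->
    (fun n => normE (subE (X n) Y)) @ \oo --> (0 : R) ->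
    Y = cls (cst 0).

End Spaces.

(* Main.v *)
From HB Require Import structures.
Require Import Defs.
From mathcomp Require Import all_boot all_order all_algebra.
From mathcomp Require Import all_classical all_reals all_analysis.
From mathcomp Require Import measurable_realfun ring lra.
Import Order.TTheory GRing.Theory Num.Theory.
Import numFieldNormedType.Exports.
Local Open Scope classical_set_scope.
Local Open Scope ring_scope.
Set Implicit Arguments.
Unset Strict Implicit.
Unset Printing Implicit Defensive.

(** Write mu for the measure phi nu. The hypothesis on phi, applied to the
    constant function 1, says that 1/phi is nu-integrable, and this lets mu
    control nu: by the arithmetic-geometric inequality,
      |h| <= h^2 phi / (2 e) + (e / 2) / phi     for all e > 0,
    so a function that is small in L2(mu) is small in L1(nu)
    ([L1_le_weighted_L2]).

    Let F_n be cylindrical functions with D F_n -> 0 in L2(mu; H) and with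
    classes converging to the class of x. By [normE_subE] there are constants
    c_n with F_n - x + c_n -> 0 in L2(mu), hence in L1(nu). The constants cancel
    in differences, so
      E |x(g) - x(g')| <= E |F_n(g) - F_n(g')| + o(1)
    where g, g' are independent Wiener paths. If the right-hand side tends to 0
    then x is nu-almost surely constant ([double_diff_const]), hence also
    mu-almost everywhere as mu << nu, and its class is zero.

    It remains to bound E |F(g) - F(g')| by the gradient of F = f(g(s_1), ...),
    with a constant that does not depend on the number of times s_i, since this
    number varies with n. This is the rotation argument of Maurey and Pisier.
    Put g_t = cos t g + sin t g' and g'_t = - sin t g + cos t g', the derivative
    of g_t. Then
      |F(g) - F(g')| <= int_0^(pi/2) |<grad f(g_t), g'_t>| dt
    ([increment_le_speed]), and the pair (g_t, g'_t) has the same law as (g, g')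
    because each pair of increments of g and g' has a centred, rotation
    invariant normal law ([increments_rotation]). By Tonelli,
      E |F(g) - F(g')| <= (pi/2) E |<grad f(g), g'>|     ([wiener_poincare_L1]).
    All integrands are nonnegative, so no integrability has to be checked.
    Finally, for fixed g the variable <grad f(g), g'> is linear in g', and its
    second moment is at most a constant times |D F(g)|_H^2
    ([mxdot_eval_second_moment], [energyE]). The inequality of the first
    paragraph, now with <grad f(g), g'> as h, bounds the right-hand side by
    int |D F|_H^2 dmu ([cylinder_increment_estimate]). *)

(** * Integration against a density, measurability of continuous functions *)
Section density.
Local Open Scope ereal_scope.
Context d (T : measurableType d) (R : realType).
Variables (mu m : {measure set T -> \bar R}) (p : T -> \bar R).
Hypotheses (p0 : forall x, 0 <= p x) (mp : measurable_fun setT p).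
Hypothesis mE : forall A, measurable A -> m A = \int[mu]_(x in A) p x.

Import HBNNSimple.

(** By monotone approximation with simple functions, for which the claim is
    linear in the hypothesis on the measure of sets. *)
Lemma integral_density (g : T -> \bar R) :
  measurable_fun setT g -> (forall x, 0 <= g x) ->
  \int[m]_x g x = \int[mu]_x (g x * p x).
Proof.
move=> mg g0; pose g_ := nnsfun_approx measurableT mg.
have cg x : limn (fun n => (g_ n x)%:E) = g x.
  by apply/cvg_lim => //; exact: cvg_nnsfun_approx.
transitivity (limn (fun n => \int[m]_x (g_ n x)%:E)).
  rewrite -monotone_convergence//.
  - by apply: eq_integral => x _; rewrite cg.
  - by move=> n; exact/measurable_EFinP.
  - by move=> n x _; rewrite lee_fin.
  - by move=> x _ a b ab; rewrite lee_fin; exact/lefP/nd_nnsfun_approx.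
transitivity (limn (fun n => \int[mu]_x ((g_ n x)%:E * p x))); last first.
  rewrite -monotone_convergence//.
  - apply: eq_integral => x _.
    have g_g n : (g_ n x)%:E <= g x.
      rewrite -cg; apply: lime_ge.
        by apply/cvg_ex; exists (g x); exact: cvg_nnsfun_approx.
      near=> a; rewrite lee_fin; apply/lefP/nd_nnsfun_approx.
      by near: a; exact: nbhs_infty_ge.
    (* The product of limits is the limit of the products except for 0 * +oo, where
     the products vanish along the sequence. *)
    have [/eqP|gp0] := eqVneq (g x * p x) 0; last first.
      have := cvgeM (neq0_mule_def gp0)
        (cvg_nnsfun_approx measurableT mg (fun x _ => g0 x) I) (cvg_cst (p x)).
      by move=> /(_ _ _)/cvg_lim -> //.
    move=> gp0; rewrite (eqP gp0).
    rewrite (_ : (fun n => _) = cst 0) ?lim_cst//; apply/funext => n/=.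
    move: gp0; rewrite mule_eq0 => /orP[|] /eqP e0; last by rewrite e0 mule0.
    have := g_g n; rewrite e0 => gn0.
    suff -> : (g_ n x)%:E = 0 by rewrite mul0e.
    by apply/eqP; rewrite eq_le gn0 lee_fin /=.
  - by move=> n; apply: emeasurable_funM => //; exact/measurable_EFinP.
  - by move=> n x _; rewrite mule_ge0// lee_fin.
  - move=> x _ a b ab; apply: lee_wpmul2r => //.
    by rewrite lee_fin; exact/lefP/nd_nnsfun_approx.
congr (limn _); apply/funext => n.
under eq_integral do rewrite fimfunE -fsumEFin//.
rewrite ge0_integral_fsum//; last 2 first.
- by move=> y; exact/measurable_EFinP/measurable_funM.
- by move=> y x _; rewrite nnfun_muleindic_ge0.
under [RHS]eq_integral => x _.
  rewrite fimfunE -fsumEFin// ge0_mule_fsuml; last first.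
    by move=> y; rewrite nnfun_muleindic_ge0.
  over.
rewrite ge0_integral_fsum//; last 2 first.
- move=> y; apply: emeasurable_funM => //; exact/measurable_EFinP/measurable_funM.
- by move=> y x _; rewrite mule_ge0// nnfun_muleindic_ge0.
apply: eq_fsbigr => r _.
have [r0|r0] := ltP r 0%R.
  by rewrite !integral0_eq// => x _; rewrite preimage_nnfun0//= indic0 mulr0 ?mul0e.
under [RHS]eq_integral => x _ do rewrite EFinM -muleA.
rewrite [RHS]ge0_integralZl//; last 2 first.
- by apply: emeasurable_funM => //; exact/measurable_EFinP.
- by move=> x _; rewrite mule_ge0// lee_fin.
under [LHS]eq_integral => x _ do rewrite EFinM.
rewrite [LHS]ge0_integralZl//; last exact/measurable_EFinP.
congr (_ * _); rewrite integral_indic// setIT mE// integral_mkcond.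
apply: eq_integral => x _; rewrite epatch_indic/=.
by rewrite muleC.
Unshelve. all: by end_near.
Qed.
End density.

Section mxmeas.
Context {R : realType}.

(** Rounding the entries down to multiples of 1/(n+1) turns [f (X x)] into a
    function of countably many values whose level sets are finite intersections of
    measurable sets; continuity of [f] gives the limit. This avoids a sigma-algebra
    on matrices. *)
Lemma continuous_mx_measurable d (T : measurableType d) k l
    (f : 'M[R]_(k, l) -> R) (X : T -> 'M[R]_(k, l)) : continuous f ->
  (forall i j, measurable_fun setT (fun x => X x i j)) ->
  measurable_fun setT (fun x => f (X x)).
Proof.
move=> cf mX.
pose r n (x : T) : 'M[int]_(k, l) := \matrix_(i, j) Num.floor (n.+1%:R * X x i j).
pose v n (q : 'M[int]_(k, l)) : 'M[R]_(k, l) := \matrix_(i, j) ((q i j)%:~R / n.+1%:R).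
apply: (@measurable_fun_cvg _ _ _ _ (fun n x => f (v n (r n x)))).
- move=> n _ B mB; rewrite setTI.
  rewrite (_ : _ @^-1` B = \bigcup_q (if q \in (fun q => f (v n q)) @^-1` B then
       \bigcap_i \bigcap_j [set x | r n x i j = q i j] else set0)).
    apply: countable_bigcupT_measurable; first exact: countableP.
    move=> q; case: ifPn => // _; apply: fin_bigcap_measurable => // i _.
    apply: fin_bigcap_measurable => // j _.
    rewrite (_ : [set x | _] = (fun x => n.+1%:R * X x i j) @^-1`
        `[(q i j)%:~R, (q i j + 1)%:~R[%classic).
      by rewrite -[X in measurable X]setTI; apply: (measurable_funM _ (mX i j)).
    apply/seteqP; split => y /=; rewrite in_itv/= mxE => h.
      by rewrite -h floor_itv.
    by apply/eqP; rewrite floor_eq.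
  apply/seteqP; split => [y fB|y [q _]].
    exists (r n y) => //=; rewrite mem_set//.
  have [/set_mem fB h /=|//] := boolP (q \in _).
  have -> // : r n y = q by apply/matrixP => i j; exact: h.
- move=> x _.
  apply: (cvg_comp (fun n => v n (r n x)) f _ (cf (X x))).
  apply/cvg_ballP => e e0.
  near=> n; rewrite /ball/=; split=> // i j; rewrite !mxE.
  have n0 : (0 : R) < n.+1%:R by rewrite ltr0n.
  have /andP[h1 h2] := floor_itv (n.+1%:R * X x i j).
  rewrite /ball/= ger0_norm; last first.
    by rewrite subr_ge0 ler_pdivrMr// [leRHS]mulrC.
  rewrite -[X in X - _](mulfK (lt0r_neq0 n0)) -mulrBl ltr_pdivrMr//.
  rewrite (lt_trans (y := 1))//.
    by rewrite ltrBlDl [ltLHS]mulrC; move: h2; rewrite intrD.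
  rewrite -ltr_pdivrMl// mulr1.
  near: n; exists (Num.bound e^-1) => //= n hn.
  by rewrite (lt_le_trans (archi_boundP _)) ?invr_ge0 ?(ltW e0)// ler_nat leqW.
Unshelve. all: by end_near. Qed.
End mxmeas.

(** * Rotation invariance and second moment of the centred normal law *)
Section lebesgue_rotation.
Local Open Scope ereal_scope.
Context {R : realType}.
Local Notation mu := (@lebesgue_measure R).
Implicit Types (K : R * R -> \bar R).

Lemma ge0_integral_lebesgue_shift (c : R) (f : R -> \bar R) :
  measurable_fun setT f -> (forall x, 0 <= f x) ->
  \int[mu]_x f (x + c)%R = \int[mu]_x f x.
Proof.
move=> mf f0.
pose t := (fun x : R => x + c)%R : measurableTypeR R -> measurableTypeR R.
have mt : measurable_fun setT t by apply: (@measurable_funD _ R R setT id (cst c)).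
have := @ge0_integral_pushforward _ _ _ _ _ _ mt mu setT f measurableT mf
  (fun x _ => f0 x).
rewrite preimage_setT => <-.
apply: eq_measure_integral => /= A mA _.
apply/esym/lebesgue_measure_unique => //= _ [[a b]] _ <-.
rewrite /pushforward (_ : t @^-1` _ = `](a - c)%R, (b - c)%R]%classic).
  by rewrite !lebesgue_measure_itv/= !lte_fin ltrD2r; case: ifPn => // _; congr EFin; ring.
by apply/seteqP; split=> x /=; rewrite !in_itv/= /t ltrBlDr lerBrDr.
Qed.

Definition shear1 (a : R) (z : R * R) : R * R := (z.1 + a * z.2, z.2)%R.
Definition shear2 (b : R) (z : R * R) : R * R := (z.1, z.2 + b * z.1)%R.
Definition rotation (c s : R) (z : R * R) : R * R :=
  (c * z.1 + s * z.2, - s * z.1 + c * z.2)%R.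

Lemma measurable_shear1 a : measurable_fun setT (shear1 a).
Proof.
apply: measurable_fun_pair => //=.
by apply: measurable_funD => //; exact: measurable_funM.
Qed.

Lemma measurable_shear2 a : measurable_fun setT (shear2 a).
Proof.
apply: measurable_fun_pair => //=.
by apply: measurable_funD => //; exact: measurable_funM.
Qed.

Lemma measurable_rotation c s : measurable_fun setT (rotation c s).
Proof.
by apply: measurable_fun_pair => //=;
  apply: measurable_funD => //; exact: measurable_funM.
Qed.

Definition lebesgue2 (K : R * R -> \bar R) := \int[mu]_x \int[mu]_y K (x, y).

Lemma lebesgue2_shear2 b K : measurable_fun setT K -> (forall z, 0 <= K z) ->
  lebesgue2 (K \o shear2 b) = lebesgue2 K.
Proof.
move=> mK K0; apply: eq_integral => x _ /=.
rewrite /shear2/= (ge0_integral_lebesgue_shift (b * x) (f := fun y => K (x, y)))//.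
exact: measurableT_comp.
Qed.

Lemma lebesgue2_shear1 a K : measurable_fun setT K -> (forall z, 0 <= K z) ->
  lebesgue2 (K \o shear1 a) = lebesgue2 K.
Proof.
move=> mK K0.
have fub H : measurable_fun setT H -> (forall z, 0 <= H z) ->
    lebesgue2 H = \int[mu]_y \int[mu]_x H (x, y).
  by move=> mH H0; exact: (@fubini_tonelli _ _ (measurableTypeR R) (measurableTypeR R)).
rewrite !fub//; last 2 first.
- by apply: measurableT_comp => //; exact: measurable_shear1.
- by move=> z; exact: K0.
apply: eq_integral => y _ /=.
rewrite /shear1/= (ge0_integral_lebesgue_shift (a * y) (f := fun x => K (x, y)))//.
exact: measurableT_comp.
Qed.

(** Apart from the identity and the half turn, a rotation is a product of three
    shears, and shears preserve the Lebesgue measure by Tonelli and translation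
    invariance. *)
Lemma rotation_shears (c s : R) : (c ^+ 2 + s ^+ 2 = 1)%R -> s != 0%R ->
  rotation c s =
  shear1 ((1 - c) / s)%R \o shear2 (- s)%R \o shear1 ((1 - c) / s)%R.
Proof.
move=> cs s0; apply/funext => -[x y]; rewrite /rotation/shear1/shear2/=.
have e : (c ^+ 2 = 1 - s ^+ 2)%R by rewrite -cs; ring.
congr pair; last by field.
have -> : (x + (1 - c) / s * y + (1 - c) / s * (y + - s * (x + (1 - c) / s * y)) =
   c * x + (1 - c ^+ 2) / s * y)%R by field.
by rewrite e; field.
Qed.

(** The assumption [0 <= c] leaves the identity as the only rotation with
    [s = 0], the case that the shears do not cover. *)
Lemma lebesgue2_rotation (c s : R) K : (c ^+ 2 + s ^+ 2 = 1)%R -> (0 <= c)%R ->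
  measurable_fun setT K -> (forall z, 0 <= K z) ->
  lebesgue2 (K \o rotation c s) = lebesgue2 K.
Proof.
move=> cs c0 mK K0; have [s0|s0] := eqVneq s 0%R.
  have c1 : c = 1%R.
    apply/eqP; rewrite -(@eqrXn2 _ 2)// expr1n; apply/eqP.
    by move: cs; rewrite s0 expr0n/= addr0.
  congr lebesgue2; apply/funext => -[x y] /=.
  by rewrite /rotation c1 s0/= !mul1r mul0r addr0 oppr0 mul0r add0r.
have m1 a := measurable_shear1 a; have m2 b := measurable_shear2 b.
rewrite rotation_shears//.
set A := shear1 _; set B := shear2 _.
have mKA : measurable_fun setT (K \o A) by exact: (measurableT_comp mK (m1 _)).
have mKAB : measurable_fun setT (K \o A \o B) by exact: (measurableT_comp mKA (m2 _)).
rewrite -[K \o _]/(((K \o A) \o B) \o A) lebesgue2_shear1//.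
  rewrite lebesgue2_shear2//; first exact: lebesgue2_shear1.
  by move=> z; exact: K0.
by move=> z; exact: K0.
Qed.

End lebesgue_rotation.

Section normal.
Local Open Scope ereal_scope.
Context {R : realType} (s : R).
Hypothesis s0 : s != 0%R.
Local Notation mu := (@lebesgue_measure R).
Local Notation N := (normal_prob 0 s).
Local Notation p := (normal_pdf 0 s).

Lemma integral_normal_prob (g : R -> \bar R) :
  measurable_fun setT g -> (forall x, 0 <= g x) ->
  \int[N]_x g x = \int[mu]_x (g x * (p x)%:E).
Proof.
move=> mg g0; apply: (integral_density (m := N)) => //.
- by move=> x; rewrite lee_fin normal_pdf_ge0.
- by apply/measurable_EFinP; exact: measurable_normal_pdf.
Qed.

Lemma normal_probN (A : set R) : measurable A -> N (-%R @^-1` A) = N A.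
Proof.
move=> mA; rewrite /normal_prob.
have mN : measurable_fun setT (-%R : measurableTypeR R -> measurableTypeR R) by apply: (@measurable_funN _ R R setT id).
have mp : measurable_fun setT (fun x => (p x)%:E).
  by apply/measurable_EFinP; exact: measurable_normal_pdf.
have := @ge0_integral_pushforward _ _ _ _ _ _ mN mu A (EFin \o p) mA
  (measurable_funTS mp).
move=> H; rewrite -[LHS](_ : \int[mu]_(x in -%R @^-1` A) ((EFin \o p) \o -%R) x = _); last first.
  apply: eq_integral => x _ /=.
  by rewrite /normal_pdf (negbTE s0) /normal_fun !subr0 sqrrN.
rewrite -H//; last by move=> x _; rewrite lee_fin normal_pdf_ge0.
by apply: eq_measure_integral => //= B mB _; exact/lebesgue_measureN.
Qed.

(** The density of the product depends on [x ^+ 2 + y ^+ 2] only. *)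
Lemma normal_prob_rotation (c t : R) (A : set (R * R)) :
  (c ^+ 2 + t ^+ 2 = 1)%R -> (0 <= c)%R -> measurable A ->
  (N \x N) (rotation c t @^-1` A) = (N \x N) A.
Proof.
move=> ct c0 mA.
have mp : measurable_fun setT (fun x => (p x)%:E).
  by apply/measurable_EFinP; exact: measurable_normal_pdf.
have NNE B : measurable B ->
    (N \x N) B = lebesgue2 (fun z => (\1_B z)%:E * ((p z.2)%:E * (p z.1)%:E)).
  move=> mB.
  have mB1 : measurable_fun setT (fun z => (\1_B z : R)%:E) by exact/measurable_EFinP.
  have mBx (x : R) : measurable_fun setT (fun y : R => (\1_B (x, y) : R)%:E).
    by apply: (measurableT_comp mB1); exact: pair1_measurable.
  have -> : (N \x N) B = \int[N \x N]_z (\1_B z)%:E by rewrite integral_indic// setIT.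
  rewrite fubini_tonelli1//=.
  rewrite integral_normal_prob; last 2 first.
  - exact: measurable_fun_fubini_tonelli_F.
  - by move=> x; apply: integral_ge0.
  apply: eq_integral => x _.
  rewrite /fubini_F integral_normal_prob//.
  rewrite -ge0_integralZr//; last first.
  - by rewrite lee_fin normal_pdf_ge0.
  - by move=> y _; rewrite mule_ge0// lee_fin normal_pdf_ge0.
  - exact: (emeasurable_funM (mBx x) mp).
  by apply: eq_integral => y _; rewrite muleA.
rewrite !NNE//; last first.
  by rewrite -[X in measurable X]setTI; exact: measurable_rotation.
have mA1 : measurable_fun setT (fun z => (\1_A z : R)%:E) by exact/measurable_EFinP.
have mK : measurable_fun setT
    (fun z : R * R => (\1_A z)%:E * ((p z.2)%:E * (p z.1)%:E)).
  apply: (emeasurable_funM mA1).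
  by apply: emeasurable_funM; exact: (measurableT_comp mp).
rewrite -(lebesgue2_rotation ct c0 mK); last first.
  by move=> z; rewrite !mule_ge0// lee_fin// normal_pdf_ge0.
congr lebesgue2; apply/funext => -[x y]/=; congr (_ * _).
rewrite -!EFinM /normal_pdf (negbTE s0) /normal_fun/= !subr0; congr EFin.
rewrite [LHS]mulrACA [RHS]mulrACA -!expRD; congr (_ * expR _)%R.
rewrite -!mulrDl; congr (_ / _)%R.
transitivity (- (c ^+ 2 + t ^+ 2) * (x ^+ 2 + y ^+ 2))%R; last by ring.
by rewrite ct; ring.
Qed.

(** The exact value is [s ^+ 2]; any bound proportional to it serves the same
    purpose. This one comes from u <= exp u with u = x^2 / (4 s^2): up to a factor,
    x^2 times the density is below the density of variance 2 s^2. *)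
Lemma normal_prob_second_moment :
  \int[N]_x (x ^+ 2)%:E <= (4 * Num.sqrt 2 * s ^+ 2)%:E.
Proof.
rewrite integral_normal_prob; last 2 first.
- by apply/measurable_EFinP; exact: measurable_funX.
- by move=> x; rewrite lee_fin sqr_ge0.
(* The deviation that doubles the variance. *)
pose s' := (Num.sqrt 2 * s)%R.
have s'0 : s' != 0%R by rewrite mulf_neq0// gt_eqF// sqrtr_gt0.
apply: (@le_trans _ _ (\int[mu]_x ((4 * Num.sqrt 2 * s ^+ 2)%:E * (normal_pdf 0 s' x)%:E))).
  apply: ge0_le_integral => //.
  - by move=> x _; rewrite mule_ge0// lee_fin ?sqr_ge0 ?normal_pdf_ge0.
  - apply: emeasurable_funM; apply/measurable_EFinP; first exact: measurable_funX.
    exact: measurable_normal_pdf.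
  - apply: emeasurable_funM; apply/measurable_EFinP => //.
    exact: measurable_normal_pdf.
  move=> x _; rewrite -!EFinM lee_fin /normal_pdf (negbTE s0) (negbTE s'0).
  have s2 : (0 < s ^+ 2)%R by rewrite exprn_even_gt0.
  have r2 : (0 < Num.sqrt 2 :> R)%R by rewrite sqrtr_gt0.
  have r22 : (Num.sqrt 2 ^+ 2 = 2 :> R)%R by rewrite sqr_sqrtr.
  have -> : normal_peak s = (Num.sqrt 2 * normal_peak s')%R.
    rewrite /normal_peak /s' exprMn r22.
    rewrite (_ : 2 * s ^+ 2 * pi *+ 2 = 2 * (s ^+ 2 * pi *+ 2))%R; last first.
      by rewrite -mulrA -mulrnAr.
    rewrite [in RHS]sqrtrM//.
    by rewrite invfM mulrA divff ?mul1r// gt_eqF.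
  rewrite /normal_fun !subr0.
  have -> : (- x ^+ 2 / (s ^+ 2 *+ 2) = - x ^+ 2 / (s' ^+ 2 *+ 2) - x ^+ 2 / (4 * s ^+ 2))%R.
    by rewrite /s' exprMn r22; field.
  rewrite expRD.
  set E1 := expR _; set E2 := expR _; set P := normal_peak _.
  have P0 : (0 <= P)%R by exact: normal_peak_ge0.
  have E10 : (0 <= E1)%R by exact: expR_ge0.
  have xE : (x ^+ 2 * E2 <= 4 * s ^+ 2)%R.
    rewrite /E2 expRN ler_pdivrMr ?expR_gt0// -ler_pdivrMl ?(mulr_gt0 _ s2)//.
    rewrite mulrC; apply: le_trans (expR_ge1Dx _).
    by rewrite lerDr.
  rewrite [leLHS](_ : _ = (Num.sqrt 2 * P * E1) * (x ^+ 2 * E2))%R; last ring.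
  rewrite [leRHS](_ : _ = (Num.sqrt 2 * P * E1) * (4 * s ^+ 2))%R; last ring.
  by rewrite ler_wpM2l// !mulr_ge0// ltW.
rewrite ge0_integralZl//.
- by rewrite integral_normal_pdf mule1.
- by apply/measurable_EFinP; exact: measurable_normal_pdf.
- by move=> x _; rewrite lee_fin normal_pdf_ge0.
- by rewrite lee_fin mulr_ge0 ?sqr_ge0// mulr_ge0.
Qed.
End normal.

(** * Functions with continuous partial derivatives along circular arcs *)
Section C1.
Context {R : realType} (k l : nat).
Local Notation M := 'M[R]_(k, l).
Local Notation e_ a := (delta_mx a.1 a.2 : M).

(** The differential of a function at a matrix, as the pairing with the matrix of
    its partial derivatives. *)
Definition mxdot (D : M) (h : M) : R := \sum_(a : 'I_k * 'I_l) h a.1 a.2 * D a.1 a.2.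

Lemma mxdot_is_linear (D : M) : linear (mxdot D : M -> R).
Proof.
move=> c x y; rewrite /mxdot scaler_sumr -big_split/=; apply: eq_bigr => a _.
by rewrite !mxE mulrDl -mulrA.
Qed.

HB.instance Definition _ D :=
  GRing.isLinear.Build R M R _ (mxdot D) (mxdot_is_linear D).

Lemma continuous_mxdot D : continuous (mxdot D : M -> R).
Proof.
suff H (s : seq ('I_k * 'I_l)) :
    continuous (fun h : M => \sum_(a <- s) h a.1 a.2 * D a.1 a.2) by exact: H.
elim: s => [|a s IH] x.
  rewrite (_ : (fun h : M => _) = cst 0); first exact: cst_continuous.
  by apply/funext => h; rewrite big_nil.
rewrite (_ : (fun h : M => _) = (fun h => h a.1 a.2 * D a.1 a.2 +
    \sum_(b <- s) h b.1 b.2 * D b.1 b.2)); last first.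
  by apply/funext => h; rewrite big_cons.
have c1 : (fun h : M => h a.1 a.2 * D a.1 a.2) h @[h --> x] --> x a.1 a.2 * D a.1 a.2.
  by apply: (@cvgM _ _ (nbhs x) _ (fun h : M => h a.1 a.2) (cst (D a.1 a.2)));
    [exact: coord_continuous|exact: cst_continuous].
exact: (cvgD c1 (IH x)).
Qed.

Lemma mx_entry_le (h : M) i j : `|h i j| <= `|h|.
Proof.
rewrite [leRHS]/Num.norm/= mx_normrE.
exact: (le_bigmax _ (fun a : 'I_k * 'I_l => `|h a.1 a.2|) (i, j)).
Qed.

Lemma norm_delta_mx_le1 (a : 'I_k * 'I_l) : `|e_ a| <= 1.
Proof.
rewrite [leLHS]/Num.norm/= mx_normrE; apply: bigmax_le => // b _.
by rewrite mxE; case: (_ && _); rewrite ?normr0 ?normr1.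
Qed.

Variable f : M -> R.
Hypothesis df : forall i j x, derivable f x (delta_mx i j).
Hypothesis cdf : forall i j, continuous (fun x => 'D_(delta_mx i j) f x).

Lemma is_derive_line (v y : M) (t : R) : derivable f (y + t *: v) v ->
  is_derive t 1 (fun t : R => f (y + t *: v)) ('D_v f (y + t *: v)).
Proof.
move=> dv.
have E : (fun h : R => h^-1 *: (((fun t : R => f (y + t *: v)) \o shift t) (h *: 1) -
      f (y + t *: v))) =
    (fun h => h^-1 *: ((f \o shift (y + t *: v)) (h *: v) - f (y + t *: v))).
  apply/funext => h /=; congr (_ *: (f _ - _)).
  by rewrite [h *: 1]mulr1 scalerDl addrCA.
by apply: DeriveDef; [rewrite /derivable E|rewrite /derive E].
Qed.

(** The mean value theorem on the segment from [y] in a coordinate direction. *)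
Lemma line_increment (y : M) (a : 'I_k * 'I_l) (t : R) : exists2 c : R, `|c| <= `|t| &
  f (y + t *: e_ a) - f y = t * 'D_(e_ a) f (y + c *: e_ a).
Proof.
pose g (t : R) : R := f (y + t *: e_ a).
pose dg (t : R) : R := 'D_(e_ a) f (y + t *: e_ a).
have dgE (u : R) : is_derive u 1 g (dg u) by exact: is_derive_line.
have cg (u v : R) : {within `[u, v], continuous g}.
  apply: continuous_subspaceT => z; apply: differentiable_continuous.
  by apply/derivable1_diffP; exact: @ex_derive _ _ _ _ _ _ _ (dgE z).
have g0 : f y = g 0 by rewrite /g scale0r addr0.
have [t0|t0] := leP 0 t.
  have [c] := MVT_segment t0 (fun x _ => dgE x) (cg 0 t).
  rewrite in_itv/= => /andP[c0 ct] E; exists c; first by rewrite !ger0_norm.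
  by rewrite g0 -[f _]/(g t) E subr0 mulrC.
have [c] := MVT_segment (ltW t0) (fun x _ => dgE x) (cg t 0).
rewrite in_itv/= => /andP[ct c0] E; exists c.
  by rewrite !ler0_norm ?(ltW t0)// lerN2.
by rewrite g0 -[f _]/(g t) -opprB E sub0r mulrN opprK mulrC.
Qed.

Definition partial_sum (s : seq ('I_k * 'I_l)) (h : M) : M :=
  \sum_(a <- s) h a.1 a.2 *: e_ a.

Lemma partial_sum_le s h : `|partial_sum s h| <= (size s)%:R * `|h|.
Proof.
rewrite /partial_sum; elim: s => [|a s IH]; first by rewrite big_nil normr0 mul0r.
rewrite big_cons (le_trans (ler_normD _ _))//= -addn1 natrD mulrDl addrC mul1r.
rewrite lerD// normrZ -[leRHS]mulr1 ler_pM// ?mx_entry_le ?norm_delta_mx_le1//.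
Qed.

(** Moving one coordinate at a time: each new coordinate costs one application of
    [line_increment], and the continuity of the partial derivatives replaces the
    derivative at the intermediate point by the one at [x]. *)
Lemma partial_sum_expansion (x : M) s (e : R) : 0 < e -> exists2 del : R, 0 < del &
  forall h : M, `|h| < del ->
  `|f (x + partial_sum s h) - f x - \sum_(a <- s) h a.1 a.2 * 'D_(e_ a) f x|
  <= (size s)%:R * e * `|h|.
Proof.
move=> e0; elim: s => [|a s [d1 d10 IH]].
  exists 1 => // h _; rewrite /partial_sum !big_nil addr0 subrr subr0 normr0.
  by rewrite !mul0r.
have /cvgrPdist_lt/(_ _ e0) := @cdf a.1 a.2 x.
move=> /nbhs_ballP[d2 /= d20 H2].
pose C : R := (size s).+1%:R.
have C0 : 0 < C by rewrite ltr0n.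
exists (Num.min d1 (d2 / C)); first by rewrite lt_min d10 divr_gt0.
move=> h; rewrite lt_min => /andP[hd1 hd2].
rewrite /partial_sum !big_cons -/(partial_sum s h) addrCA [X in f X]addrC.
have [c cle E] := line_increment (x + partial_sum s h) a (h a.1 a.2).
set y := x + partial_sum s h in E *.
set S := \sum_(b <- s) _.
rewrite (_ : _ - _ - _ = (f y - f x - S) +
   h a.1 a.2 * ('D_(e_ a) f (y + c *: e_ a) - 'D_(e_ a) f x)); last first.
  by rewrite mulrBr -E; ring.
rewrite (le_trans (ler_normD _ _))//= -addn1 natrD !mulrDl mul1r.
rewrite lerD ?IH// normrM mulrC ler_pM ?mx_entry_le//.
rewrite distrC ltW//; apply: H2; rewrite -ball_normE/= /y.
rewrite -addrA opprD addrA subrr sub0r normrN (le_lt_trans (ler_normD _ _))//.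
rewrite (@le_lt_trans _ _ (C * `|h|))//.
  rewrite /C -addn1 natrD mulrDl mul1r lerD ?partial_sum_le//.
  rewrite normrZ -[leRHS]mulr1 ler_pM// ?norm_delta_mx_le1//.
  by rewrite (le_trans cle)// mx_entry_le.
by rewrite mulrC -ltr_pdivlMr.
Qed.

Definition gradmx (x : M) : M := \matrix_(i, j) 'D_(delta_mx i j) f x.

Lemma partial_sum_enum h : partial_sum (index_enum _) h = h.
Proof.
rewrite [RHS]matrix_sum_delta /partial_sum pair_bigA/=.
by apply: eq_bigr => a _.
Qed.

Lemma gradmx_near (x : M) (eps : R) : 0 < eps -> \forall h \near (0 : M),
  `|f (h + x) - (f x + mxdot (gradmx x) h)| <= eps * `|h|.
Proof.
move=> eps0.
pose I := index_enum ('I_k * 'I_l)%type.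
have e0 : 0 < eps / (size I).+1%:R by rewrite divr_gt0.
have [del del0 H] := partial_sum_expansion x I e0.
apply/nbhs_ballP; exists del => //= h; rewrite -ball_normE/= sub0r normrN => hd.
have := H h hd; rewrite partial_sum_enum => {}H.
rewrite (addrC h) opprD addrA (_ : mxdot _ _ = \sum_(a <- I) h a.1 a.2 * 'D_(e_ a) f x).
  apply: (le_trans H); rewrite ler_wpM2r// mulrCA ler_piMr ?(ltW eps0)//.
  by rewrite ler_pdivrMr// mul1r ler_nat.
by apply: eq_bigr => a _; rewrite mxE.
Qed.

Lemma diff_gradmx x : 'd f x = mxdot (gradmx x) :> (M -> R).
Proof.
apply: diff_unique; first exact: continuous_mxdot.
apply/eqaddoP => eps; exact: gradmx_near.
Qed.

Lemma C1_differentiable x : differentiable f x.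
Proof.
apply/diff_locallyP; rewrite diff_gradmx; split; first exact: continuous_mxdot.
apply/eqaddoP => eps; exact: gradmx_near.
Qed.
End C1.

Lemma is_derive_curve (R : realType) k l (f : 'M[R]_(k, l) -> R)
    (df : forall i j x, derivable f x (delta_mx i j))
    (cdf : forall i j, continuous (fun x => 'D_(delta_mx i j) f x))
    (E E' : 'M[R]_(k, l)) (t : R) :
  is_derive t 1 (fun t => f (cos t *: E + sin t *: E'))
    (mxdot (gradmx f (cos t *: E + sin t *: E')) (- sin t *: E + cos t *: E')).
Proof.
have [dcos dsin] : differentiable (cos : R -> R) t /\ differentiable (sin : R -> R) t.
  by split; apply/derivable1_diffP.
pose c (t : R) := cos t *: E + sin t *: E'.
have cdiff : differentiable c t.
  by apply: differentiableD; exact: differentiableZl.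
have fdiff : differentiable f (c t) by exact: C1_differentiable.
apply: DeriveDef; first by apply/derivable1_diffP; exact: (@differentiable_comp _ _ _ _ c f).
rewrite (@deriveE _ _ _ (f \o c)); last exact: differentiable_comp.
rewrite diff_comp//=.
have cE : 'D_1 c t = - sin t *: E + cos t *: E'.
  pose c1 (t : R) := cos t *: E; pose c2 (t : R) := sin t *: E'.
  have dc1 : differentiable c1 t by exact: differentiableZl.
  have dc2 : differentiable c2 t by exact: differentiableZl.
  have e1 : 'D_1 c1 t = - sin t *: E.
    rewrite (deriveE _ dc1).
    have /(congr1 (fun g => g 1)) /= -> := diffZl E dcos.
    by rewrite -(deriveE _ dcos) (@derive_val _ _ _ _ _ _ _ (is_derive_cos t)).
  have e2 : 'D_1 c2 t = cos t *: E'.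
    rewrite (deriveE _ dc2).
    have /(congr1 (fun g => g 1)) /= -> := diffZl E' dsin.
    by rewrite -(deriveE _ dsin) (@derive_val _ _ _ _ _ _ _ (is_derive_sin t)).
  rewrite -e1 -e2.
  exact: (@deriveD _ _ _ c1 c2 t 1 ((@derivable1_diffP _ _ c1 t).2 dc1)
    ((@derivable1_diffP _ _ c2 t).2 dc2)).
rewrite -(deriveE _ cdiff) cE.
exact: (congr1 (fun g => g (- sin t *: E + cos t *: E')) (diff_gradmx df cdf (c t))).
Qed.

Section interpolation.
Context {R : realType} (k l : nat) (f : 'M[R]_(k, l) -> R).
Hypothesis df : forall i j x, derivable f x (delta_mx i j).
Hypothesis cdf : forall i j, continuous (fun x => 'D_(delta_mx i j) f x).

Definition circle (E E' : 'M[R]_(k, l)) (t : R) : 'M[R]_(k, l) :=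
  cos t *: E + sin t *: E'.

Definition circle' (E E' : 'M[R]_(k, l)) (t : R) : 'M[R]_(k, l) :=
  - sin t *: E + cos t *: E'.

Lemma continuous_circle E E' : continuous (circle E E').
Proof.
move=> t; apply: (@cvgD _ _ _ (nbhs t) _ (fun t => cos t *: E) (fun t => sin t *: E')).
  by apply: cvgZr_tmp; exact: continuous_cos.
by apply: cvgZr_tmp; exact: continuous_sin.
Qed.

Lemma continuous_circle' E E' : continuous (circle' E E').
Proof.
move=> t; apply: (@cvgD _ _ _ (nbhs t) _ (fun t => - sin t *: E) (fun t => cos t *: E')).
  by apply: cvgZr_tmp; apply: cvgN; exact: continuous_sin.
by apply: cvgZr_tmp; exact: continuous_cos.
Qed.

Definition speed E E' t := mxdot (gradmx f (circle E E' t)) (circle' E E' t).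

Lemma continuous_speed E E' : continuous (speed E E').
Proof.
suff H (s : seq ('I_k * 'I_l)) :
    continuous (fun t => \sum_(a <- s) circle' E E' t a.1 a.2 *
      'D_(delta_mx a.1 a.2) f (circle E E' t)).
  rewrite (_ : speed E E' = (fun t => \sum_(a <- index_enum _) circle' E E' t a.1 a.2 *
      'D_(delta_mx a.1 a.2) f (circle E E' t))) //.
  by apply/funext => t; apply: eq_bigr => a _; rewrite [gradmx _ _ _ _]mxE.
elim: s => [|a s IH] x.
  rewrite (_ : (fun _ => _) = cst 0); first exact: cst_continuous.
  by apply/funext => h; rewrite big_nil.
rewrite (_ : (fun t => _) = (fun t => circle' E E' t a.1 a.2 *
      'D_(delta_mx a.1 a.2) f (circle E E' t) +
    \sum_(b <- s) circle' E E' t b.1 b.2 *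
      'D_(delta_mx b.1 b.2) f (circle E E' t))); last first.
  by apply/funext => h; rewrite big_cons.
have c1 : (fun t => circle' E E' t a.1 a.2) @ x --> circle' E E' x a.1 a.2.
  apply: (@continuous_comp _ _ _ (circle' E E') (fun M => M a.1 a.2)).
    exact: continuous_circle'.
  exact: coord_continuous.
have c2 : (fun t => 'D_(delta_mx a.1 a.2) f (circle E E' t)) @ x -->
    'D_(delta_mx a.1 a.2) f (circle E E' x).
  apply: (@continuous_comp _ _ _ (circle E E') (fun M => 'D_(delta_mx a.1 a.2) f M)).
    exact: continuous_circle.
  exact: cdf.
exact: (cvgD (cvgM c1 c2) (IH x)).
Qed.

(** [circle E E'] runs from [E] to [E'] on the time interval [0, pi/2], and
    [circle' E E'] is its velocity. *)
Lemma increment_le_speed E E' :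
  (`|f E - f E'|%:E <= \int[lebesgue_measure]_(t in `[0%R, (pi / 2)%R]) `|speed E E' t|%:E)%E.
Proof.
have cf : continuous (fun t => f (circle E E' t)).
  move=> t; apply: (@continuous_comp _ _ _ (circle E E') f).
    exact: continuous_circle.
  exact: differentiable_continuous (C1_differentiable df cdf _).
have pi2 : (0 : R) < pi / 2 by rewrite divr_gt0// pi_gt0.
have d1 (t : R) : is_derive t 1 (fun t => f (circle E E' t)) (speed E E' t).
  exact: is_derive_curve.
have dLR : derivable_oo_LRcontinuous (fun t => f (circle E E' t)) 0 (pi / 2).
  split; [by move=> t _; exact: @ex_derive _ _ _ _ _ _ _ (d1 t)
    |exact: cvg_at_right_filter (cf _)|exact: cvg_at_left_filter (cf _)].
have d1E : {in `]0, (pi / 2)[, (fun t => f (circle E E' t))^`()%classic =1 speed E E'}.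
  by move=> t _; rewrite derive1E (@derive_val _ _ _ _ _ _ _ (d1 t)).
have := continuous_FTC2 pi2
  (continuous_subspaceT (@continuous_speed E E')) dLR d1E.
rewrite /circle cos0 sin0 cos_pihalf sin_pihalf !scale0r !scale1r addr0 add0r => H.
rewrite distrC -[X in (X <= _)%E]/(`|(f E')%:E - (f E)%:E|%E) -H.
apply: le_abse_integral => //; apply/measurable_EFinP/measurable_funTS.
exact: continuous_measurable_fun (@continuous_speed E E').
Qed.
End interpolation.

(** * Laws of finite families of independent variables *)
Section boxes.
Context {dS} {S : measurableType dS} {I : finType}.

Definition boxes : set (set (I -> S)) :=
  [set C | exists2 A : I -> set S, (forall a, measurable (A a)) &
    C = [set w | forall a, A a (w a)]].

(** Families indexed by a finite type, with the product sigma-algebra. *)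
Definition vec := g_sigma_algebraType boxes.

Lemma boxes_setI : setI_closed boxes.
Proof.
move=> _ _ [A mA ->] [B mB ->]; exists (fun a => A a `&` B a).
  by move=> a; exact: measurableI.
by apply/seteqP; split=> w /= => [[Aw Bw] a|h]; [|split=> a; case: (h a)].
Qed.

Lemma boxes_setT : boxes setT.
Proof. by exists (fun=> setT) => //; apply/seteqP; split. Qed.

Lemma measurable_coord a : measurable_fun setT (fun w : vec => w a).
Proof.
move=> _ B mB; rewrite setTI; apply: sub_sigma_algebra.
exists (fun b => if b == a then B else setT).
  by move=> b; case: ifPn.
apply/seteqP; split=> w /= => [Bw b|/(_ a)]; last by rewrite eqxx.
by case: eqP => // ->.
Qed.

Context {d} {T : measurableType d} {R : realType}.

Lemma measurable_box (X : I -> T -> S) (A : I -> set S) :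
  (forall a, measurable_fun setT (X a)) -> (forall a, measurable (A a)) ->
  measurable [set x | forall a, A a (X a x)].
Proof.
move=> mX mA; rewrite (_ : [set x | _] = \bigcap_a (X a @^-1` A a)).
  apply: fin_bigcap_measurable => // a _; rewrite -[X in measurable X]setTI.
  exact: mX.
by apply/seteqP; split=> x /= h a => [_|]; exact: h.
Qed.

Lemma measurable_vec (X : I -> T -> S) :
  (forall a, measurable_fun setT (X a)) ->
  measurable_fun setT ((fun x a => X a x) : T -> vec).
Proof.
move=> mX; apply: measurability => //.
by move=> _ [_ [A mA ->] <-]; rewrite setTI; exact: measurable_box.
Qed.

Local Open Scope ereal_scope.

(** Boxes are stable under intersection and generate the sigma-algebra, so they
    determine the two image measures. *)
Lemma eq_law_integral (P : {finite_measure set T -> \bar R}) (X Y : I -> T -> S) :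
  (forall a, measurable_fun setT (X a)) -> (forall a, measurable_fun setT (Y a)) ->
  (forall A : I -> set S, (forall a, measurable (A a)) ->
     P [set x | forall a, A a (X a x)] = P [set x | forall a, A a (Y a x)]) ->
  forall Phi : vec -> \bar R, measurable_fun setT Phi -> (forall w, 0 <= Phi w) ->
  \int[P]_x Phi (X^~ x) = \int[P]_x Phi (Y^~ x).
Proof.
move=> mX mY XY Phi mPhi Phi0.
pose tX := (fun x a => X a x) : T -> vec.
pose tY := (fun x a => Y a x) : T -> vec.
have mtX : measurable_fun setT tX := measurable_vec mX.
have mtY : measurable_fun setT tY := measurable_vec mY.
have := ge0_integral_pushforward mtX P measurableT mPhi (fun w _ => Phi0 w).
rewrite preimage_setT => <-.
have := ge0_integral_pushforward mtY P measurableT mPhi (fun w _ => Phi0 w).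
rewrite preimage_setT => <-.
apply: eq_measure_integral => /= B mB _.
apply: (@measure_unique _ R vec boxes (fun=> setT) erefl boxes_setI _ _
  (pushforward P tX) (pushforward P tY)) => //=.
- by move=> _; exact: boxes_setT.
- by apply/seteqP; split => // w _; exists 0%N.
- by move=> _ [A mA ->]; exact: XY.
- by move=> _; rewrite /pushforward preimage_setT ltey_eq fin_num_measure.
Qed.

(** Used with sign changes of one coordinate and with rotations of all the pairs of
    coordinates at once. *)
Lemma eq_law_preserving (P : {finite_measure set T -> \bar R}) (X : I -> T -> S)
    (mu : I -> set S -> \bar R) (rho : I -> S -> S) :
  (forall a, measurable_fun setT (X a)) ->
  (forall A : I -> set S, (forall a, measurable (A a)) ->
     P [set x | forall a, A a (X a x)] = \prod_a mu a (A a)) ->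
  (forall a, measurable_fun setT (rho a)) ->
  (forall a A, measurable A -> mu a (rho a @^-1` A) = mu a A) ->
  forall Phi : vec -> \bar R, measurable_fun setT Phi -> (forall w, 0 <= Phi w) ->
  \int[P]_x Phi (fun a => rho a (X a x)) = \int[P]_x Phi (X^~ x).
Proof.
move=> mX XE mrho rhoE.
apply: (@eq_law_integral P (fun a x => rho a (X a x)) X) => //.
  by move=> a; exact: measurableT_comp.
move=> A mA; apply: etrans; last exact: (esym (XE A mA)).
apply: etrans (XE (fun a => rho a @^-1` A a) _) _.
  by move=> a; rewrite -[X in measurable X]setTI; exact: mrho.
by apply: eq_bigr => a _; rewrite rhoE.
Qed.
End boxes.
Arguments vec {dS} S I.

Section pairing.
Local Open Scope ereal_scope.
Context {I : finType} {R : realType} {dS} {S : measurableType dS}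
  {dS'} {S' : measurableType dS'} {d} {T : measurableType d}.
Variables (P : {finite_measure set T -> \bar R}) (X : I -> T -> S) (X' : I -> T -> S').
Variables (mu : I -> probability S R) (mu' : I -> probability S' R).
Hypotheses (mX : forall a, measurable_fun setT (X a))
  (mX' : forall a, measurable_fun setT (X' a)).
Hypothesis XE : forall (B : I -> set S) (B' : I -> set S'),
  (forall a, measurable (B a)) -> (forall a, measurable (B' a)) ->
  P [set x | forall a, B a (X a x) /\ B' a (X' a x)] =
  \prod_a (mu a (B a) * mu' a (B' a)).

Let rect (A : set (S * S')) := exists B B', [/\ measurable B, measurable B' & A = B `*` B'].

Let pairing_partial (l : seq I) (A : I -> set (S * S')) :
  (forall a, measurable (A a)) -> (forall a, a \notin l -> rect (A a)) ->
  P [set x | forall a, A a (X a x, X' a x)] = \prod_a (mu a \x mu' a) (A a).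
Proof.
elim: l A => [|b l IH] A mA rA.
  have /choice[B hB] : forall a, exists B, exists B', [/\ measurable B, measurable B' & A a = B `*` B'].
    by move=> a; apply: rA.
  have /choice[B' {}hB] := hB.
  rewrite (_ : [set x | _] = [set x | forall a, B a (X a x) /\ B' a (X' a x)]).
    rewrite XE => [|a|a]; last 2 first.
    - by have [] := hB a.
    - by have [] := hB a.
    by apply: eq_bigr => a _; have [? ? ->] := hB a; rewrite product_measure1E.
  by apply/seteqP; split=> x /= + a => /(_ a); have [_ _ ->] := hB a.
(* Both sides are finite measures in the set at the coordinate b; by induction they
   agree on rectangles. *)
pose upd (E : set (S * S')) a := if a == b then E else A a.
have mupd E : measurable E -> forall a, measurable (upd E a).
  by move=> mE a; rewrite /upd; case: ifPn.
pose Q := [set x | forall a, upd setT a (X a x, X' a x)].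
have mXX a : measurable_fun setT (fun x => (X a x, X' a x)).
  exact: measurable_fun_pair.
have mQ : measurable Q by apply: measurable_box => //; exact: mupd.
pose m1 := pushforward (mrestr P mQ) (fun x => (X b x, X' b x)).
have m1E E : m1 E = P [set x | forall a, upd E a (X a x, X' a x)].
  rewrite /m1 /pushforward /mrestr; congr (P _); apply/seteqP; split=> x /=.
    move=> [Ex Qx] a; have := Qx a; rewrite /upd; case: eqP => // -> _; exact: Ex.
  move=> h; split; first by have := h b; rewrite /upd eqxx.
  by move=> a; have := h a; rewrite /upd; case: eqP.
pose c : \bar R := \prod_(a | a != b) (mu a \x mu' a) (A a).
have c0 : 0 <= c by apply: prode_ge0 => a _; exact: measure_ge0.
have cfin : c \is a fin_num.
  apply: prode_fin_num => a _; rewrite ge0_fin_numE; last exact: measure_ge0.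
  apply: (@le_lt_trans _ _ ((mu a \x mu' a) (setT `*` setT))).
    by rewrite setXTT; apply: le_measure; rewrite ?inE.
  rewrite product_measure1E// lte_mul_pinfty// ?fin_num_measure//.
  by rewrite ltey_eq fin_num_measure.
pose m2 := mscale (NngNum (fine_ge0 c0)) (mu b \x mu' b).
have m2E E : m2 E = \prod_a (mu a \x mu' a) (upd E a).
  rewrite /m2 /mscale/= fineK// (bigD1 b)//= muleC /upd eqxx; congr (_ * _).
  by apply: eq_bigr => a /negbTE ->.
have Ab : upd (A b) = A by apply/funext => a; rewrite /upd; case: eqP => [->|].
rewrite -Ab -m2E -m1E.
pose G : set (set (S * S')) := [set C | rect C].
apply: (@measure_unique _ R _ G (fun=> setT) _ _ _ _ m1 m2) => //=.
- rewrite measurable_prod_measurableType; congr (<<s _ >>).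
  apply/seteqP; split=> C /=.
    by move=> [A' mA' [B' mB' <-]]; exists A', B'.
  by move=> [A' [B' [mA' mB' ->]]]; exists A' => //; exists B'.
- move=> _ _ [B1 [B1' [? ? ->]]] [B2 [B2' [? ? ->]]].
  by exists (B1 `&` B2), (B1' `&` B2'); rewrite -setXI; split => //; exact: measurableI.
- by move=> _; exists setT, setT; rewrite setXTT.
- by apply/seteqP; split => // w _; exists 0%N.
- move=> E [B [B' [mB mB' EE]]].
  have mE : measurable E by rewrite EE; exact: measurableX.
  apply: etrans (m1E E) _; apply: etrans (esym (m2E E)).
  apply: IH; first exact: mupd.
  move=> a al; rewrite /upd; case: eqP => [_|/eqP ab]; first by exists B, B'.
  by apply: rA; rewrite inE negb_or ab.
- move=> _; apply: (@le_lt_trans _ _ (P setT)); last by rewrite ltey_eq fin_num_measure.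
  rewrite [leLHS](m1E setT); apply: le_measure; rewrite ?inE//.
Qed.

(** The hypothesis speaks of rectangles in each pair of coordinates only, whereas
    the image of a rectangle under a rotation is not a rectangle: this lemma gives
    the product formula for all measurable sets of pairs. *)
Lemma pairing_law (A : I -> set (S * S')) : (forall a, measurable (A a)) ->
  P [set x | forall a, A a (X a x, X' a x)] = \prod_a (mu a \x mu' a) (A a).
Proof.
move=> mA; apply: (@pairing_partial (enum I)) => // a.
by rewrite mem_enum.
Qed.
End pairing.

(** * Increments of the Wiener process *)
Section wiener.
Context {R : realType} {d : nat} (nu : probability (Omega R d) R).
Hypothesis hnu : is_wiener nu.
Context (k : nat) (s : 'I_k.+1 -> R).
Hypothesis hs : time_points s.
Local Notation I := ('I_k.+1 * 'I_d)%type.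

(** The times 0, s_1, ..., s_k: the values at the s_i are sums of the increments
    over the cells of this grid, which are independent. *)
Definition grid (m : nat) : R := if m is m'.+1 then s (inord m') else 0.

Lemma grid_lt (i : nat) : (i < k.+1)%N -> grid i < grid i.+1.
Proof.
have [s0 sinc _] := hs; case: i => [_|i ik]; rewrite /grid.
  by rewrite (_ : inord 0 = ord0)//; apply/val_inj; rewrite /= inordK.
by apply: sinc; rewrite !inordK// (ltn_trans _ ik).
Qed.

Lemma grid_le (i j : nat) : (i <= j)%N -> (j <= k.+1)%N -> grid i <= grid j.
Proof.
elim: j => [|j IH]; first by rewrite leqn0 => /eqP ->.
rewrite leq_eqVlt => /orP[/eqP -> //|ij jk].
by rewrite (le_trans (IH _ (ltnW jk)))// ltW// grid_lt.
Qed.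

Lemma grid_last : grid k.+1 = 1.
Proof.
have [_ _ <-] := hs; rewrite /grid; congr s.
by apply/val_inj; rewrite /= inordK.
Qed.

Lemma grid01 (i : nat) : (i <= k.+1)%N -> 0 <= grid i <= 1.
Proof.
move=> ik; rewrite -grid_last grid_le// andbT.
by rewrite -[0]/(grid 0) grid_le.
Qed.

Lemma gridS (i : 'I_k.+1) : grid i.+1 = s i.
Proof. by rewrite /grid inord_val. Qed.

Definition incr (a : I) (g : Omega R d) : R :=
  at_time g (grid a.1.+1) 0 a.2 - at_time g (grid a.1) 0 a.2.

Lemma measurable_at_time (t : R) (j : 'I_d) : 0 <= t <= 1 ->
  measurable_fun setT (fun g : Omega R d => at_time g t 0 j).
Proof.
move=> t01 _ B mB; rewrite setTI; apply: sub_sigma_algebra.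
by exists t, j, B; split.
Qed.

Lemma measurable_incr a : measurable_fun setT (incr a).
Proof.
by apply: measurable_funB; apply: measurable_at_time; rewrite grid01// ltnW.
Qed.

Definition sdev (a : I) : R := Num.sqrt (grid a.1.+1 - grid a.1).

Lemma sdev_neq0 a : sdev a != 0.
Proof. by rewrite gt_eqF// sqrtr_gt0 subr_gt0 grid_lt. Qed.

Lemma sdev_sqr a : sdev a ^+ 2 = grid a.1.+1 - grid a.1.
Proof. by rewrite sqr_sqrtr// subr_ge0 ltW// grid_lt. Qed.

Lemma incr_law (B : I -> set R) : (forall a, measurable (B a)) ->
  nu [set g | forall a, B a (incr a g)] = (\prod_a normal_prob 0 (sdev a) (B a))%E.
Proof.
move=> mB.
have := @hnu k.+1 grid (fun i j => B (i, j)) (lexx _) grid_lt _ (fun i j => mB (i, j)).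
rewrite grid_last => /(_ (lexx _)); rewrite pair_bigA/= => H.
rewrite (_ : [set g | _] = [set g | forall i j, B (i, j)
  (at_time g (grid i.+1) 0 j - at_time g (grid i) 0 j)]).
  by rewrite H; apply: eq_bigr => -[].
by apply/seteqP; split=> g /= h => [i j|[i j]]; exact: h.
Qed.

Definition cumul (w : I -> R) : 'M[R]_(k.+1, d) :=
  \matrix_(i, j) \sum_(m < k.+1 | (m <= i)%N) w (m, j).

Lemma eval_at_cumul g : eval_at s g = cumul (incr^~ g).
Proof.
apply/matrixP => i j; rewrite !mxE.
pose X m := at_time g (grid m) 0 j.
transitivity (X i.+1 - X 0%N).
  by rewrite /X gridS [X in _ - X](_ : _ = 0) ?subr0// /at_time /= path_start mxE.
rewrite -telescope_sumr// big_mkord.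
by rewrite (big_ord_widen _ (fun m => X m.+1 - X m) (ltn_ord i)).
Qed.

Lemma cumul_linear (a b : R) w w' :
  cumul (fun m => a * w m + b * w' m) = a *: cumul w + b *: cumul w'.
Proof.
apply/matrixP => i j; rewrite !mxE big_split/= !mulr_sumr//.
Qed.

(** The coefficient of one increment in a linear combination of the values of the
    path: the increment over the cell [m] enters the value at each later time. *)
Definition tailsum (v : 'M[R]_(k.+1, d)) (a : I) : R :=
  \sum_(i < k.+1 | (a.1 <= i)%N) v i a.2.

Lemma mxdot_cumul v w : mxdot v (cumul w) = \sum_a tailsum v a * w a.
Proof.
rewrite /mxdot -(pair_bigA _ (fun i j => cumul w i j * v i j))/= exchange_big/=.
rewrite [RHS](_ : _ = \sum_i \sum_j tailsum v (i, j) * w (i, j)); last first.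
  by rewrite pair_bigA/=; apply: eq_bigr => -[].
rewrite [RHS]exchange_big/=.
apply: eq_bigr => j _.
under eq_bigr => i _ do rewrite mxE mulr_suml big_mkcond.
rewrite exchange_big/=; apply: eq_bigr => m _.
rewrite /tailsum/= mulr_suml [RHS]big_mkcond/=; apply: eq_bigr => i _.
by case: ifPn => // _; rewrite mulrC.
Qed.

Local Open Scope ereal_scope.

(** Changing the sign of one increment preserves the joint law and cancels the
    mixed terms. Compared with computing covariances, all integrands stay
    nonnegative. *)
Lemma flip_orthogonal (c : I -> R) (l : seq I) : uniq l ->
  \int[nu]_g ((\sum_(a <- l) c a * incr a g) ^+ 2)%:E =
  \sum_(a <- l) \int[nu]_g ((c a * incr a g) ^+ 2)%:E.
Proof.
elim: l => [_|a l IH /=/andP[al ul]].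
  by rewrite big_nil; under eq_integral do rewrite big_nil expr0n/=; rewrite integral0.
rewrite big_cons -IH//.
(* Half of the square, so that adding its value after the sign change gives the
   square without the mixed term. *)
pose h : R := (2^-1)%R.
pose Phi (w : vec R I) : \bar R := (h * (\sum_(b <- a :: l) c b * w b) ^+ 2)%:E.
have mPhi : measurable_fun setT Phi.
  apply/measurable_EFinP; apply: measurable_funM => //; apply: measurable_funX.
  by apply: measurable_sum => b; apply: measurable_funM => //; exact: measurable_coord.
have Phi0 w : 0 <= Phi w by rewrite lee_fin mulr_ge0 ?invr_ge0 ?sqr_ge0.
pose rho (b : I) : R -> R := if b == a then -%R else id.
have mrho b : measurable_fun setT (rho b) by rewrite /rho; case: ifP => _ //; exact: measurable_funN.
have rhoE (b : I) (A : set R) : measurable A ->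
    normal_prob 0 (sdev b) (rho b @^-1` A) = normal_prob 0 (sdev b) A.
  by move=> mA; rewrite /rho; case: ifP => _; [exact: normal_probN (sdev_neq0 b) _ mA|].
have flip := eq_law_preserving measurable_incr incr_law mrho rhoE mPhi Phi0.
pose r g : R := (\sum_(b <- l) c b * incr b g)%R.
have mr : measurable_fun setT r.
  by apply: measurable_sum => b; apply: measurable_funM => //; exact: measurable_incr.
have mq : measurable_fun setT (fun g => ((c a * incr a g) ^+ 2)%:E).
  apply/measurable_EFinP; apply: measurable_funX; apply: measurable_funM => //.
  exact: measurable_incr.
have mPX : measurable_fun setT (fun g => Phi (incr^~ g)).
  exact: measurableT_comp mPhi (measurable_vec measurable_incr).
have mPrX : measurable_fun setT (fun g => Phi (fun b => rho b (incr b g))).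
  apply: measurableT_comp mPhi (measurable_vec _) => b.
  by apply: measurableT_comp => //; exact: measurable_incr.
rewrite -ge0_integralD//=; last 3 first.
- by move=> g _; rewrite lee_fin sqr_ge0.
- by move=> g _; rewrite lee_fin sqr_ge0.
- by apply/measurable_EFinP; exact: measurable_funX.
transitivity (\int[nu]_g (Phi (incr^~ g) + Phi (incr^~ g))).
  apply: eq_integral => g _; rewrite /Phi -EFinD; congr EFin.
  by rewrite /h; field.
rewrite ge0_integralD// -[X in _ + X]flip -ge0_integralD//.
apply: eq_integral => g _; rewrite /Phi -!EFinD; congr EFin.
rewrite !big_cons /rho eqxx.
rewrite (_ : (\sum_(b <- l) _ * (if _ then _ else _) _)%R = r g); last first.
  apply: eq_big_seq => b bl; case: eqP => // ba.
  by rewrite ba (negbTE al) in bl.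
by rewrite -/(r g) /h; field.
Qed.

(** Taking the other sets of the product formula equal to the whole line shows
    that one increment is normal. *)
Lemma incr_second_moment (a : I) :
  \int[nu]_g ((incr a g) ^+ 2)%:E <= (4 * Num.sqrt 2 * (grid a.1.+1 - grid a.1))%:E.
Proof.
rewrite -sdev_sqr; apply: le_trans (normal_prob_second_moment (sdev_neq0 a)).
have mx2 : measurable_fun setT (fun x : R => (x ^+ 2)%:E).
  by apply/measurable_EFinP; exact: measurable_funX.
have mi : @measurable_fun _ _ (Omega R d) (measurableTypeR R) setT (incr a).
  exact: measurable_incr.
have := ge0_integral_pushforward mi nu measurableT mx2
  (fun x _ => (sqr_ge0 x : is_true ((0 : \bar R) <= (x ^+ 2)%:E))).
rewrite preimage_setT /= => <-.
rewrite le_eqVlt; apply/orP; left; apply/eqP.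
apply: eq_measure_integral => /= B mB _.
have := @incr_law (fun b => if b == a then B else setT).
rewrite (bigD1 a)//= eqxx big1 ?mule1; last first.
  by move=> b /negbTE ->; exact: probability_setT.
move=> <-; last by move=> b; case: ifP.
congr (nu _); apply/seteqP; split=> g /=; first by move=> Bg b; case: eqP => // ->.
by move=> /(_ a); rewrite eqxx.
Qed.

(** The right-hand side is, up to the factor, the squared Cameron-Martin norm of
    the broken line with slopes given by the tail sums; see [innerH_broken_line]. *)
Lemma mxdot_eval_second_moment (v : 'M[R]_(k.+1, d)) :
  \int[nu]_g ((mxdot v (eval_at s g)) ^+ 2)%:E <=
  (4 * Num.sqrt 2 * \sum_(a : I) (grid a.1.+1 - grid a.1) * (tailsum v a) ^+ 2)%:E.
Proof.
under eq_integral do rewrite eval_at_cumul mxdot_cumul.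
rewrite flip_orthogonal ?index_enum_uniq//.
rewrite mulr_sumr -sumEFin; apply: lee_sum => a _.
under eq_integral do rewrite exprMn EFinM.
rewrite ge0_integralZl//; last 3 first.
- by apply/measurable_EFinP; apply: measurable_funX; exact: measurable_incr.
- by move=> g _; rewrite lee_fin sqr_ge0.
- by rewrite lee_fin sqr_ge0.
rewrite [X in _ <= X%:E](_ : _ = tailsum v a ^+ 2 *
  (4 * Num.sqrt 2 * (grid a.1.+1 - grid a.1)))%R; last by ring.
rewrite [X in _ <= X]EFinM; apply: lee_wpmul2l; first by rewrite lee_fin sqr_ge0.
exact: incr_second_moment.
Qed.

End wiener.

(** * An L1 Poincare inequality for the Wiener measure *)
Lemma mule_indic_eq (R : realType) (T : Type) (D : set T) (t : T) (A K : \bar R) :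
  (t \in D -> A = K) -> (A * (\1_D t)%:E = K * (\1_D t)%:E)%E.
Proof. by rewrite indicE; case: (t \in D) => [->|_]; rewrite // !mule0. Qed.

Section poincare.
Context {R : realType} {d : nat} (nu : probability (Omega R d) R).
Hypothesis hnu : is_wiener nu.
Context (k : nat) (s : 'I_k.+1 -> R).
Hypothesis hs : time_points s.
Local Notation I := ('I_k.+1 * 'I_d)%type.
Local Notation OT := ((Omega R d * Omega R d) * measurableTypeR R)%type.
Local Open Scope ereal_scope.

Let P : {finite_measure set (Omega R d * Omega R d)%type -> \bar R} :=
  product_subprobability ((nu : subprobability _ _), (nu : subprobability _ _)).

(** Each pair of increments has the law N \x N, which rotations preserve, and
    distinct pairs are independent. *)
Lemma increments_rotation (c t : R) (Phi : vec (R * R)%type I -> \bar R) :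
  (c ^+ 2 + t ^+ 2 = 1)%R -> (0 <= c)%R ->
  measurable_fun setT Phi -> (forall w, 0 <= Phi w) ->
  \int[P]_z Phi (fun a => rotation c t (incr s a z.1, incr s a z.2)) =
  \int[P]_z Phi (fun a => (incr s a z.1, incr s a z.2)).
Proof.
move=> ct c0 mPhi Phi0.
have mX a : measurable_fun setT (fun z : (Omega R d * Omega R d)%type => incr s a z.1).
  by apply: measurableT_comp => //; exact: measurable_incr.
have mX' a : measurable_fun setT (fun z : (Omega R d * Omega R d)%type => incr s a z.2).
  by apply: measurableT_comp => //; exact: measurable_incr.
pose N (a : I) : probability (measurableTypeR R) R := normal_prob 0 (sdev s a).
have XE (B B' : I -> set R) : (forall a, measurable (B a)) -> (forall a, measurable (B' a)) ->
    P [set z | forall a, B a (incr s a z.1) /\ B' a (incr s a z.2)] =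
    \prod_a (N a (B a) * N a (B' a)).
  move=> mB mB'.
  rewrite big_split/= -!(incr_law hnu hs)// -product_measure1E//; last 2 first.
  - by apply: measurable_box => // a; exact: measurable_incr.
  - by apply: measurable_box => // a; exact: measurable_incr.
  congr (P _); apply/seteqP; split=> z /= => [h|[h h'] a]; last by split.
  by split=> a; have [] := h a.
have XXE := @pairing_law I R _ (measurableTypeR R) _ (measurableTypeR R) _ _ P
  (fun a z => incr s a z.1) (fun a z => incr s a z.2) N N mX mX' XE.
have mXX a : measurable_fun setT
    (fun z : (Omega R d * Omega R d)%type => (incr s a z.1, incr s a z.2)).
  exact: measurable_fun_pair.
have rotE a A : measurable A -> (N a \x N a) (rotation c t @^-1` A) = (N a \x N a) A.
  by move=> mA; apply: normal_prob_rotation => //; exact: sdev_neq0.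
have H := @eq_law_preserving _ (measurableTypeR R * measurableTypeR R)%type I _ _ _ P
  (fun a z => (incr s a z.1, incr s a z.2)) (fun a => N a \x N a)%E
  (fun=> rotation c t) mXX XXE (fun=> measurable_rotation c t) rotE Phi mPhi Phi0.
exact: H.
Qed.

Variable f : 'M[R]_(k.+1, d) -> R.
Hypothesis df : forall i j x, derivable f x (delta_mx i j).
Hypothesis cf : continuous f.
Hypothesis cdf : forall i j, continuous (fun x => 'D_(delta_mx i j) f x).

Lemma measurable_mxdot {dT} {T : measurableType dT} (X Y : T -> 'M[R]_(k.+1, d)) :
  (forall i j, measurable_fun setT (fun x => X x i j)) ->
  (forall i j, measurable_fun setT (fun x => Y x i j)) ->
  measurable_fun setT (fun x => mxdot (gradmx f (X x)) (Y x)).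
Proof.
move=> mX mY; apply: measurable_sum => a; apply: measurable_funM => //.
under eq_fun do rewrite mxE.
exact: (continuous_mx_measurable (@cdf a.1 a.2)).
Qed.

Lemma measurable_cumul {dT} {T : measurableType dT} (X : I -> T -> R) i j :
  (forall a, measurable_fun setT (X a)) ->
  measurable_fun setT (fun x => cumul (X^~ x) i j).
Proof.
move=> mX; under eq_fun do rewrite mxE big_mkcond/=.
by apply: measurable_sum => m; case: (_ <= _)%N.
Qed.

Lemma measurable_eval_at i j : measurable_fun setT (fun g : Omega R d => eval_at s g i j).
Proof.
under eq_fun do rewrite mxE.
by apply: measurable_at_time; rewrite -gridS grid01.
Qed.

Let E (g : Omega R d) := eval_at s g.

(** Position and velocity at time [t] form a rotation of the pair of independent
    paths, so the law of the speed is the same at all these times. *)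
Lemma speed_law (t : R) : (0 <= cos t)%R ->
  \int[P]_z `|speed f (E z.1) (E z.2) t|%:E =
  \int[P]_z `|mxdot (gradmx f (E z.1)) (E z.2)|%:E.
Proof.
move=> c0.
pose Phi (w : vec (R * R)%type I) : \bar R :=
  `|mxdot (gradmx f (cumul (fun a => (w a).1))) (cumul (fun a => (w a).2))|%:E.
have mPhi : measurable_fun setT Phi.
  apply/measurable_EFinP; apply: measurableT_comp => //; apply: measurable_mxdot => i j.
    apply: (measurable_cumul (X := fun a (w : vec _ I) => (w a).1)) => a.
    exact: (measurableT_comp measurable_fst (measurable_coord a)).
  apply: (measurable_cumul (X := fun a (w : vec _ I) => (w a).2)) => a.
  exact: (measurableT_comp measurable_snd (measurable_coord a)).
have := increments_rotation (cos2Dsin2 t) c0 mPhi (fun w => normr_ge0 _).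
rewrite /Phi /rotation/=.
under eq_integral => z _ do rewrite !cumul_linear -!eval_at_cumul//.
move=> ->.
by under eq_integral => z _ do rewrite -!eval_at_cumul//.
Qed.

(** Exchange the expectation with the integral of the speed along the arc, whose
    length is pi/2. *)
Lemma wiener_poincare_L1 :
  \int[P]_z `|f (E z.1) - f (E z.2)|%:E <=
  (pi / 2)%:E * \int[P]_z `|mxdot (gradmx f (E z.1)) (E z.2)|%:E.
Proof.
set K := \int[P]_z `|mxdot _ _|%:E.
have mE1 i j : measurable_fun setT (fun z : (Omega R d * Omega R d)%type => E z.1 i j).
  exact: (measurableT_comp (measurable_eval_at i j) measurable_fst).
have mE2 i j : measurable_fun setT (fun z : (Omega R d * Omega R d)%type => E z.2 i j).
  exact: (measurableT_comp (measurable_eval_at i j) measurable_snd).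
pose D : set R := `[0%R, (pi / 2)%R]%classic.
pose F (zt : OT) : \bar R :=
  (`|speed f (E zt.1.1) (E zt.1.2) zt.2|)%:E * (\1_D zt.2)%:E.
have mt : measurable_fun setT (fun zt : OT => zt.2 : R).
  exact: measurable_snd.
have mcos : measurable_fun setT (fun zt : OT => cos (zt.2 : R)).
  apply: measurableT_comp mt; apply: continuous_measurable_fun; exact: continuous_cos.
have msin : measurable_fun setT (fun zt : OT => sin (zt.2 : R)).
  apply: measurableT_comp mt; apply: continuous_measurable_fun; exact: continuous_sin.
have mspeed : measurable_fun setT
    (fun zt : OT =>
      (`|speed f (E zt.1.1) (E zt.1.2) zt.2|)%:E).
  apply/measurable_EFinP; apply: measurableT_comp => //; apply: measurable_mxdot => i j.
    rewrite (_ : (fun zt : OT => _) = (fun zt : OT =>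
        cos zt.2 * E zt.1.1 i j + sin zt.2 * E zt.1.2 i j)%R); last first.
      by apply/funext => zt; rewrite !mxE.
    apply: measurable_funD; apply: measurable_funM => //.
      exact: (measurableT_comp (mE1 i j) measurable_fst).
    exact: (measurableT_comp (mE2 i j) measurable_fst).
  rewrite (_ : (fun zt : OT => _) = (fun zt : OT =>
      - sin zt.2 * E zt.1.1 i j + cos zt.2 * E zt.1.2 i j)%R); last first.
    by apply/funext => zt; rewrite !mxE.
  apply: measurable_funD; apply: measurable_funM => //; first exact: measurable_funN.
    exact: (measurableT_comp (mE1 i j) measurable_fst).
  exact: (measurableT_comp (mE2 i j) measurable_fst).
have mF : measurable_fun setT F.
  have mD : measurable_fun setT (\1_D : R -> R) by apply: measurable_indic; exact: measurable_itv.
  apply: emeasurable_funM => //; apply/measurable_EFinP.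
  exact: (measurableT_comp mD mt).
have F0 zt : 0 <= F zt by rewrite mule_ge0// lee_fin.
apply: (@le_trans _ _ (\int[P]_z \int[lebesgue_measure]_t F (z, t))).
  apply: ge0_le_integral => //.
  - apply/measurable_EFinP; apply: measurableT_comp => //.
    by apply: measurable_funB; apply: continuous_mx_measurable.
  - exact: measurable_fun_fubini_tonelli_F.
  move=> z _; apply: (le_trans (increment_le_speed df cdf _ _)).
  rewrite [leLHS]integral_mkcond; rewrite le_eqVlt; apply/orP; left; apply/eqP.
  by apply: eq_integral => t _; rewrite epatch_indic.
rewrite (fubini_tonelli F)//.
apply: (@le_trans _ _ (\int[lebesgue_measure]_(t in D) K)).
  rewrite [leRHS]integral_mkcond; rewrite le_eqVlt; apply/orP; left; apply/eqP.
  apply: eq_integral => t _; rewrite epatch_indic.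
  have mst : measurable_fun setT
      (fun z : (Omega R d * Omega R d)%type => `|speed f (E z.1) (E z.2) t|%:E).
    exact: (measurableT_comp mspeed (pair2_measurable t)).
  have D0 : 0 <= (\1_D t : R)%:E by rewrite lee_fin.
  have Z := @ge0_integralZr _ _ _ P setT measurableT _ mst (\1_D t)%:E (fun _ _ => normr_ge0 _) D0.
  transitivity (\int[P]_x `|speed f (E x.1) (E x.2) t|%:E * (\1_D t : R)%:E).
    exact: Z.
  set A := \int[P]_x _.
  have AK : t \in D -> A = K.
    rewrite inE /D/= in_itv/= => /andP[t0 t1]; apply: speed_law.
    by apply: cos_ge0_pihalf; rewrite t1 andbT (le_trans _ t0)// oppr_le0 divr_ge0// pi_ge0.
  exact: (mule_indic_eq AK).
have mD : lebesgue_measure D = (pi / 2)%:E.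
  by rewrite /D lebesgue_measure_itv/= lte_fin divr_gt0 ?pi_gt0//= oppr0 adde0.
rewrite integral_cst; last exact: measurable_itv.
suff : K * lebesgue_measure D <= (pi / 2)%:E * K by [].
by rewrite mD muleC.
Qed.
End poincare.

(** * The Cameron-Martin norm of the gradient *)
Lemma derive1_affine (R : realType) n (u : R -> 'rV[R]_n) (a0 w : 'rV[R]_n) (p q r : R) :
  p < r < q -> (forall y, p < y < q -> u y = a0 + y *: w) -> derive1 u r = w.
Proof.
move=> /andP[pr rq] uE; rewrite /derive1; apply/cvg_lim => //.
apply: cvg_near_cst; near=> h.
rewrite !uE ?pr//.
  rewrite opprD addrACA subrr add0r -scalerBl addrK scalerA mulVf ?scale1r//.
  by near: h; exact: nbhs_dnbhs_neq.
apply/andP; split.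
  rewrite -ltrBlDr; near: h; apply: nbhs_dnbhs; apply: lt_nbhsr.
  by rewrite subr_lt0.
rewrite -ltrBrDr; near: h; apply: nbhs_dnbhs; apply: lt_nbhsl.
by rewrite subr_gt0.
Unshelve. all: by end_near. Qed.

Section innerH.
Context {R : realType} {d k : nat} (s : 'I_k.+1 -> R).
Hypothesis hs : time_points s.
Local Notation I := ('I_k.+1 * 'I_d)%type.
Variable v : 'M[R]_(k.+1, d).

Definition broken_line (r : R) : 'rV[R]_d := \sum_(i < k.+1) Num.min (s i) r *: row i v.

(** On the cell [m] the summand i is still growing, with slope [row i v], exactly
    when s_i lies to the right of the cell. *)
Lemma derive1_broken_line (m : 'I_k.+1) (r : R) : grid s m < r < grid s m.+1 ->
  derive1 broken_line r = \row_j tailsum v (m, j).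
Proof.
move=> mr.
(* On the cell, the summands with s_i to the left of it are constant. *)
apply: (@derive1_affine _ _ _ (\sum_(i < k.+1 | ~~ (m <= i)%N) s i *: row i v) _ _ _ _ mr).
move=> y /andP[my ym]; rewrite /broken_line (bigID (fun i : 'I_k.+1 => (m <= i)%N))/= addrC.
congr (_ + _).
  apply: eq_bigr => i; rewrite -ltnNge => im; rewrite min_l// -gridS ltW//.
  by rewrite (le_lt_trans _ my)// grid_le// ltnW.
have -> : \row_j tailsum v (m, j) = \sum_(i < k.+1 | (m <= i)%N) row i v.
  apply/rowP => j; rewrite !mxE summxE; apply: eq_bigr => i _.
  by rewrite mxE.
rewrite scaler_sumr; apply: eq_bigr => i mi; rewrite min_r// -gridS ltW//.
by rewrite (lt_le_trans ym)// grid_le.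
Qed.

Lemma grid_cell (r : R) : 0 <= r <= 1 -> (forall m, (m <= k.+1)%N -> r != grid s m) ->
  exists m : 'I_k.+1, grid s m < r < grid s m.+1.
Proof.
move=> /andP[r0 r1] rN.
suff H n : (n <= k.+1)%N -> r < grid s n -> exists m : 'I_k.+1, grid s m < r < grid s m.+1.
  by apply: (H k.+1) => //; rewrite lt_neqAle rN// (grid_last hs).
elim: n => [_|n IH nk rn]; first by rewrite ltNge r0.
have [rn'|] := ltP r (grid s n); first by apply: IH => //; exact: ltnW.
rewrite le_eqVlt eq_sym (negbTE (rN n (ltnW nk)))/= => nr.
by exists (Ordinal nk); rewrite /= nr.
Qed.

Let C (m : 'I_k.+1) : R := \sum_j tailsum v (m, j) ^+ 2.

(** The derivative is constant on each cell, and the grid points form a null set.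
    The membership in the Cameron-Martin space provides the measurability of the
    derivative, whose values at the grid points are arbitrary. *)
Lemma innerH_broken_line : cameron_martin broken_line ->
  innerH broken_line broken_line = \sum_(a : I) (grid s a.1.+1 - grid s a.1) * tailsum v a ^+ 2.
Proof.
move=> [_ _ mcm].
have sqE r : dotv (derive1 broken_line r) (derive1 broken_line r) = \sum_j (derive1 broken_line r 0 j) ^+ 2.
  by apply: eq_bigr => j _; rewrite expr2.
rewrite /innerH /Rintegral.
under eq_integral do rewrite sqE.
pose J (m : 'I_k.+1) : set R := `]grid s m, grid s m.+1[%classic.
have JE (m : 'I_k.+1) r : grid s m < r < grid s m.+1 ->
    forall m' : 'I_k.+1, \1_(J m') r = (m' == m)%:R :> R.
  move=> /andP[mr rm] m'; rewrite indicE; congr (_%:R); congr nat_of_bool.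
  apply/idP/eqP => [|->]; last by rewrite inE /J/= in_itv/= mr.
  rewrite inE /J/= in_itv/= => /andP[m'r rm']; apply/val_inj/eqP; rewrite eqn_leq.
  apply/andP; split; rewrite leqNgt; apply/negP => ltm.
    have := lt_trans rm (le_lt_trans (grid_le hs ltm (ltnW (ltn_ord _))) m'r).
    by rewrite ltxx.
  have := lt_trans rm' (le_lt_trans (grid_le hs ltm (ltnW (ltn_ord _))) mr).
  by rewrite ltxx.
have -> : (\int[lebesgue_measure]_(r in `[0%R, 1%R]) (\sum_j derive1 broken_line r 0 j ^+ 2)%:E =
   \int[lebesgue_measure]_(r in `[0%R, 1%R]) \sum_m (C m * \1_(J m) r)%:E)%E.
  apply: ge0_ae_eq_integral => //.
  - apply/measurable_EFinP; apply: measurable_sum => j; apply: measurable_funX.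
    exact: (mcm j).1.
  - apply: emeasurable_sum => m; apply/measurable_EFinP; apply: measurable_funM => //.
    apply: measurable_funTS; apply: measurable_indic; exact: measurable_itv.
  - by move=> r _; rewrite lee_fin sumr_ge0// => j _; rewrite sqr_ge0.
  - move=> r _; apply: sume_ge0 => m _; rewrite lee_fin mulr_ge0//.
    by rewrite sumr_ge0// => j _; rewrite sqr_ge0.
  pose N : set R := (grid s) @` `I_k.+2.
  have fN : finite_set N by apply: finite_image; exact: finite_II.
  exists N; split.
  - rewrite (_ : N = \bigcup_(x in N) [set x]).
      by apply: fin_bigcup_measurable => // x _; exact: measurable_set1.
    by apply/seteqP; split=> [x Nx|x [y Ny ->//]]; exists x.
  - by apply: countable_lebesgue_measure0; exact: finite_set_countable.
  move=> r /= /not_implyP[r01] h; apply: contrapT => rN; apply: h.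
  have [|m mr] := grid_cell r01.
    move=> m mk; apply/eqP => rE; apply: rN; exists m => //=.
  rewrite (derive1_broken_line mr) sumEFin; congr EFin.
  rewrite (bigD1 m)//= (JE _ _ mr) eqxx mulr1 [X in _ + X]big1 ?addr0.
    by apply: eq_bigr => j _; rewrite mxE.
  by move=> m' /negbTE m'm; rewrite (JE _ _ mr) m'm mulr0.
rewrite ge0_integral_sum//; last 2 first.
- move=> m; apply/measurable_EFinP; apply: measurable_funM => //.
  by apply: measurable_funTS; apply: measurable_indic; exact: measurable_itv.
- move=> m r _; rewrite lee_fin mulr_ge0//.
  by rewrite sumr_ge0// => j _; rewrite sqr_ge0.
rewrite (_ : (\sum_m _)%E = (\sum_m C m * (grid s m.+1 - grid s m))%:E); last first.
  rewrite -sumEFin; apply: eq_bigr => m _.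
  have C0 : 0 <= C m by rewrite sumr_ge0// => j _; rewrite sqr_ge0.
  under eq_integral do rewrite EFinM.
  rewrite ge0_integralZl//; last first.
    apply/measurable_EFinP; apply: measurable_funTS; apply: measurable_indic.
    exact: measurable_itv.
  rewrite [RHS]EFinM integral_indic//; last exact: measurable_itv.
  rewrite setIidl; last first.
    move=> r; rewrite /J/= !in_itv/= => /andP[mr rm].
    have /andP[g0 _] := grid01 hs (ltnW (ltn_ord m)).
    have /andP[_ g1] := grid01 hs (ltn_ord m).
    by rewrite (le_trans g0 (ltW mr)) (le_trans (ltW rm) g1).
  have muJ : lebesgue_measure (J m) = (grid s m.+1 - grid s m)%:E.
    by rewrite /J lebesgue_measure_itv/= lte_fin (grid_lt hs (ltn_ord m)) -EFinB.
  suff : ((C m)%:E * lebesgue_measure (J m) = (C m)%:E * (grid s m.+1 - grid s m)%:E)%E by [].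
  by rewrite muJ.
rewrite /= -(pair_bigA _ (fun (i : 'I_k.+1) (j : 'I_d) => (grid s i.+1 - grid s i) * tailsum v (i, j) ^+ 2))/=.
apply: eq_bigr => m _; rewrite /C mulr_suml; apply: eq_bigr => j _; exact: mulrC.
Qed.
End innerH.

Lemma cylD_broken_line (R : realType) d k (s : 'I_k.+1 -> R) (f : 'M[R]_(k.+1, d) -> R) g :
  cylD s f g = broken_line s (gradmx f (eval_at s g)).
Proof.
apply/funext => r; rewrite /cylD /broken_line; apply: eq_bigr => i _; congr (_ *: _).
by apply/rowP => j; rewrite !mxE.
Qed.

(** * The weighted measure *)
(** The conventions 1/0 = +oo and 1/+oo = 0 make the inequality hold also where
    the weight vanishes or is infinite. *)
Lemma weighted_amgm (R : realType) (h e : R) (r : \bar R) : 0 < e -> (0 <= r)%E ->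
  (`|h|%:E <= (h ^+ 2)%:E * (r * (2 * e)^-1%:E) + 1%:E / r * (e / 2)%:E)%E.
Proof.
move=> e0; have e20 : 0 < e / 2 by rewrite divr_gt0.
have e2V : 0 < (2 * e)^-1 by rewrite invr_gt0 mulr_gt0.
case: r => [r|_|//].
  rewrite lee_fin le_eqVlt eq_sym => /orP[/eqP ->|r0].
    rewrite mul0e mule0 add0e inve0 mul1e gt0_mulye ?lte_fin// leey //.
  rewrite inver gt_eqF// mul1e -!EFinM -EFinD lee_fin.
  have -> : h ^+ 2 * (r / (2 * e)) + r^-1 * (e / 2) = (h ^+ 2 * r ^+ 2 + e ^+ 2) / (2 * e * r).
    by field; rewrite !gt_eqF.
  rewrite ler_pdivlMr ?mulr_gt0//.
  have := sqr_ge0 (`|h| * r - e); rewrite -[h ^+ 2]real_normK ?num_real//.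
  nra.
rewrite invey mule0 mul0e adde0.
have [->|h0] := eqVneq h 0; first by rewrite normr0 expr0n/= mul0e.
rewrite gt0_mulye ?lte_fin// gt0_muley ?leey// lte_fin exprn_even_gt0//.
Qed.

Lemma cst1_cylfun (R : realType) d : cylfuns (cst 1 : Omega R d -> R).
Proof.
exists 0%N, (fun _ => 1), (cst 1); split => //.
- split=> // i j; have := ltn_ord j; have := ltn_ord i.
  by case: i j => [[]//] ? [[]//].
- move=> l; have [c ->] : exists c, pderiv l (cst 1 : 'M[R]_(1, d) -> R) = cst c.
    elim: l => [|a l [c IH]] /=; first by exists 1.
    by exists 0; rewrite IH; apply/funext => x; rewrite derive_cst.
  split; [by move=> i j x; exact: derivable_cst|exact: cst_continuous|].
  by exists `|c|, 0%N => x; rewrite expr0 mulr1.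
Qed.

Section weighted.
Local Open Scope ereal_scope.
Context {R : realType} {d : nat} (nu : probability (Omega R d) R).
Variables (phi : Omega R d -> \bar R) (phi0 : forall g, 0 <= phi g)
  (iphi : nu.-integrable setT phi).
Local Notation mu := (weighted_measure phi0 iphi).
Hypothesis iV : nu.-integrable setT (fun g => 1%:E / phi g).

Let mphi : measurable_fun setT phi. Proof. by case/integrableP: iphi. Qed.
Let mV : measurable_fun setT (fun g => 1%:E / phi g).
Proof. by case/integrableP: iV. Qed.
Let V0 g : 0 <= 1%:E / phi g. Proof. by rewrite mul1e inve_ge0. Qed.

Lemma integral_weighted (g : Omega R d -> \bar R) :
  measurable_fun setT g -> (forall x, 0 <= g x) ->
  \int[mu]_x g x = \int[nu]_x (g x * phi x).
Proof. exact: integral_density. Qed.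

Lemma weighted_fin : mu setT \is a fin_num.
Proof.
rewrite ge0_fin_numE; last exact: measure_ge0.
have /integrableP[_] := iphi.
by under eq_integral do rewrite gee0_abs//.
Qed.

Lemma weighted_dominates (N : set (Omega R d)) : measurable N -> nu N = 0 -> mu N = 0.
Proof. by move=> mN N0; apply: null_set_integral => //; exact: measurable_funTS. Qed.

Definition inv_weight_mass : R := fine (\int[nu]_g (1%:E / phi g)).

Lemma inv_weight_massE : \int[nu]_g (1%:E / phi g) = inv_weight_mass%:E.
Proof.
rewrite /inv_weight_mass fineK// ge0_fin_numE ?integral_ge0//.
have /integrableP[_] := iV.
by under eq_integral do rewrite gee0_abs//.
Qed.

Lemma inv_weight_mass_ge0 : (0 <= inv_weight_mass)%R.
Proof. by rewrite fine_ge0// integral_ge0. Qed.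

(** Integrate [weighted_amgm]. *)
Lemma L1_le_weighted_L2 (h : Omega R d -> R) (e : R) : measurable_fun setT h -> (0 < e)%R ->
  \int[nu]_g `|h g|%:E <=
  (\int[mu]_g (h g ^+ 2)%:E) * (2 * e)^-1%:E + (inv_weight_mass * (e / 2))%:E.
Proof.
move=> mh e0.
have mh2 : measurable_fun setT (fun g => (h g ^+ 2)%:E).
  by apply/measurable_EFinP; exact: measurable_funX.
have h20 g : 0 <= (h g ^+ 2)%:E by rewrite lee_fin sqr_ge0.
have e2V : 0 <= ((2 * e)^-1)%:E by rewrite lee_fin invr_ge0 mulr_ge0// ltW.
have e20 : 0 <= (e / 2)%:E by rewrite lee_fin divr_ge0// ltW.
have mA : measurable_fun setT (fun g => (h g ^+ 2)%:E * phi g) by exact: emeasurable_funM.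
rewrite integral_weighted// EFinM -inv_weight_massE -!ge0_integralZr//; last first.
  by move=> g _; rewrite mule_ge0.
rewrite -ge0_integralD//; last 4 first.
- by move=> g _; rewrite !mule_ge0.
- exact: emeasurable_funM.
- by move=> g _; rewrite mule_ge0.
- exact: emeasurable_funM.
apply: ge0_le_integral => //.
- by apply/measurable_EFinP; exact: measurableT_comp.
- by apply: emeasurable_funD; exact: emeasurable_funM.
- by move=> g _; rewrite -muleA; exact: weighted_amgm.
Qed.
End weighted.

(** * Cylindrical functions with small gradient *)
Section cylinder_estimate.
Local Open Scope ereal_scope.
Context {R : realType} {d : nat} (nu : probability (Omega R d) R).
Hypothesis hnu : is_wiener nu.
Variables (phi : Omega R d -> \bar R) (phi0 : forall g, 0 <= phi g)
  (iphi : nu.-integrable setT phi).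
Local Notation mu := (weighted_measure phi0 iphi).
Hypothesis iV : nu.-integrable setT (fun g => 1%:E / phi g).
Context (k : nat) (s : 'I_k.+1 -> R) (f : 'M[R]_(k.+1, d) -> R).
Hypotheses (hs : time_points s) (hf : Cp_infty f) (hu : L2H mu (cylD s f)).

Let mphi : measurable_fun setT phi. Proof. by case/integrableP: iphi. Qed.
Let mV : measurable_fun setT (fun g => 1%:E / phi g).
Proof. by case/integrableP: iV. Qed.
Let V0 g : 0 <= 1%:E / phi g. Proof. by rewrite mul1e inve_ge0. Qed.

Let df i j x : derivable f x (delta_mx i j).
Proof. by have [] := hf [::]. Qed.
Let cf : continuous f. Proof. by have [] := hf [::]. Qed.
Let cdf i j : continuous (fun x => 'D_(delta_mx i j) f x).
Proof. by have [] := hf [:: (i, j)]. Qed.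

Let P : {finite_measure set (Omega R d * Omega R d)%type -> \bar R} :=
  product_subprobability ((nu : subprobability _ _), (nu : subprobability _ _)).

(** The squared Cameron-Martin norm of the gradient ([energyE]), in a form whose
    measurability is visible. *)
Definition energy (g : Omega R d) : R :=
  (\sum_(a : 'I_k.+1 * 'I_d) (grid s a.1.+1 - grid s a.1) *
     tailsum (gradmx f (eval_at s g)) a ^+ 2)%R.

Lemma energyE g : innerH (cylD s f g) (cylD s f g) = energy g.
Proof.
have [cm _ _] := hu; rewrite cylD_broken_line innerH_broken_line//.
by rewrite -cylD_broken_line.
Qed.

Lemma energy_ge0 g : (0 <= energy g)%R.
Proof.
apply: sumr_ge0 => a _; rewrite mulr_ge0 ?sqr_ge0// subr_ge0 ltW//.
exact: grid_lt.
Qed.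

Lemma measurable_energy : measurable_fun setT energy.
Proof.
apply: measurable_sum => a; apply: measurable_funM => //; apply: measurable_funX.
under eq_fun do rewrite /tailsum big_mkcond/=.
apply: measurable_sum => i; case: (_ <= _)%N => //.
under eq_fun do rewrite mxE.
apply: (continuous_mx_measurable (@cdf i a.2)) => i' j'.
exact: measurable_eval_at.
Qed.

(** For fixed [g], apply [weighted_amgm] with weight [phi g] under the integral
    over the second path, and bound the second moment by the energy at [g]. *)
Lemma cylinder_increment_estimate (e : R) : (0 < e)%R ->
  \int[P]_z `|f (eval_at s z.1) - f (eval_at s z.2)|%:E <=
  (pi / 2)%:E * ((4 * Num.sqrt 2)%:E * (\int[mu]_g (innerH (cylD s f g) (cylD s f g))%:E)
     * (2 * e)^-1%:E + (inv_weight_mass nu phi * (e / 2))%:E).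
Proof.
move=> e0; apply: le_trans (wiener_poincare_L1 hnu hs df cf cdf) _.
apply: lee_wpmul2l; first by rewrite lee_fin divr_ge0// pi_ge0.
have e2V : 0 <= ((2 * e)^-1)%:E by rewrite lee_fin invr_ge0 mulr_ge0// ltW.
have e20 : 0 <= (e / 2)%:E by rewrite lee_fin divr_ge0// ltW.
pose c : R := (4 * Num.sqrt 2)%R.
have c0 : 0 <= c%:E by rewrite lee_fin mulr_ge0.
have mE := measurable_energy.
have mEe : measurable_fun setT (fun g => (energy g)%:E) by exact/measurable_EFinP.
have E0 g : 0 <= (energy g)%:E by rewrite lee_fin energy_ge0.
have mB : measurable_fun setT (fun g => (energy g)%:E * phi g) by exact: emeasurable_funM.
have mBc : measurable_fun setT (fun g => c%:E * ((energy g)%:E * phi g)).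
  exact: emeasurable_funM.
under [in leRHS]eq_integral do rewrite energyE.
rewrite integral_weighted// -ge0_integralZl//; last by move=> g _; rewrite mule_ge0.
rewrite [(inv_weight_mass _ _ * _)%:E]EFinM -inv_weight_massE// -!ge0_integralZr//; last first.
  by move=> g _; rewrite !mule_ge0.
rewrite -ge0_integralD//; last 4 first.
- by move=> g _; rewrite !mule_ge0.
- exact: emeasurable_funM.
- by move=> g _; rewrite mule_ge0.
- exact: emeasurable_funM.
pose a (z : (Omega R d * Omega R d)%type) : R :=
  mxdot (gradmx f (eval_at s z.1)) (eval_at s z.2).
have ma : measurable_fun setT a.
  apply: (measurable_mxdot cdf) => i j.
    exact: (measurableT_comp (measurable_eval_at hs i j) measurable_fst).
  exact: (measurableT_comp (measurable_eval_at hs i j) measurable_snd).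
have maN : measurable_fun setT (fun z => `|a z|%:E).
  by apply/measurable_EFinP; exact: measurableT_comp.
apply: (@le_trans _ _ (\int[nu]_g \int[nu]_h `|a (g, h)|%:E)).
  rewrite le_eqVlt; apply/orP; left; apply/eqP.
  exact: (@fubini_tonelli1 _ _ _ _ _ nu nu (fun z => `|a z|%:E) maN (fun z => normr_ge0 _)).
apply: ge0_le_integral => //.
- by move=> g _; exact: integral_ge0.
- exact: (measurable_fun_fubini_tonelli_F (fun z => `|a z|%:E)).
- by apply: emeasurable_funD; apply: emeasurable_funM.
move=> g _.
have mag : measurable_fun setT (fun h => a (g, h)).
  exact: (measurableT_comp ma (pair1_measurable g)).
have mag2 : measurable_fun setT (fun h => (a (g, h) ^+ 2)%:E).
  by apply/measurable_EFinP; exact: measurable_funX.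
have r0 : 0 <= phi g * (2 * e)^-1%:E by rewrite mule_ge0.
have t0 : 0 <= 1%:E / phi g * (e / 2)%:E by rewrite mule_ge0.
apply: (@le_trans _ _ (\int[nu]_h ((a (g, h) ^+ 2)%:E * (phi g * (2 * e)^-1%:E) +
    1%:E / phi g * (e / 2)%:E))).
  apply: ge0_le_integral => //.
  - by apply/measurable_EFinP; exact: measurableT_comp.
  - by apply: emeasurable_funD => //; exact: emeasurable_funM.
  - by move=> h _; exact: weighted_amgm.
rewrite ge0_integralD//; last 2 first.
- by move=> h _; rewrite mule_ge0// lee_fin sqr_ge0.
- exact: emeasurable_funM.
rewrite ge0_integralZr//; last by move=> h _; rewrite lee_fin sqr_ge0.
rewrite integral_cst//; set n1 := (X in _ + _ * X <= _).
have -> : n1 = 1 by exact: (probability_setT nu).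
rewrite mule1; apply: leeD => //.
rewrite muleA; apply: lee_wpmul2r => //; rewrite [leRHS]muleA.
apply: lee_wpmul2r => //; rewrite -EFinM.
exact: (mxdot_eval_second_moment hnu hs (gradmx f (eval_at s g))).
Qed.
End cylinder_estimate.

(** * The norm modulo constants *)
Section quotient_norm.
Context {R : realType} {d : nat} (mu : {measure set (Omega R d) -> \bar R}).
Hypothesis mufin : mu setT \is a fin_num.

Lemma Lfun2_cst (c : R) : cst c \in Lfun mu 2%:E.
Proof.
rewrite inE; apply/andP; split; first by rewrite inE/=; exact: measurable_cst.
rewrite inE/= /finite_norm unlock /= poweR_lty//.
under eq_integral do rewrite /= -?EFinM.
rewrite integral_cst//= -ge0_fin_numE ?fin_numM//.
Qed.

Lemma Lfun2_add (x y : Omega R d -> R) : x \in Lfun mu 2%:E -> y \in Lfun mu 2%:E ->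
  (fun g => x g + y g) \in Lfun mu 2%:E.
Proof.
have p1 : (1 <= 2%:E :> \bar R)%E by rewrite lee_fin ler1n.
by have [_ +] := Lfun_addr_closed mu p1; exact.
Qed.

Lemma Lfun2_opp (x : Omega R d -> R) : x \in Lfun mu 2%:E ->
  (fun g => - x g) \in Lfun mu 2%:E.
Proof.
by move=> xL; exact: (Lfun_oppr_closed xL).
Qed.

Lemma Lfun2_measurable (x : Omega R d -> R) : x \in Lfun mu 2%:E -> measurable_fun setT x.
Proof. by move=> /sub_Lfun_mfun; rewrite inE. Qed.

(** Needed for the zero-mean representative to be what its name says: without a
    witness the choice operator would return a default value. *)
Lemma zero_mean_shift (D : Omega R d -> R) : D \in Lfun mu 2%:E ->
  exists c : R, (\int[mu]_g (D g - c)%:E = 0)%E.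
Proof.
move=> DL; have /Lfun1_integrable iD := Lfun_subset12 mufin DL.
have ic (c : R) : mu.-integrable setT (fun=> c%:E).
  by apply/Lfun1_integrable; exact: (Lfun_subset12 mufin (Lfun2_cst c)).
have fD : (\int[mu]_g (D g)%:E)%E \is a fin_num by exact: integrable_fin_num.
pose I := fine (\int[mu]_g (D g)%:E)%E; pose m := fine (mu setT).
(* If m = 0 then the integral of D vanishes too, and division by 0 is harmless. *)
exists (I / m); under eq_integral do rewrite EFinB.
rewrite integralB//= integral_cst// -(fineK fD) -/I -(fineK mufin) -/m.
have [m0|m0] := eqVneq m 0; last by rewrite -EFinM divfK// subee.
have mu0 : mu setT = 0 by rewrite -(fineK mufin) -/m m0.
rewrite m0 mule0 sube0 /I null_set_integral//.
by have /integrableP[] := iD.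
Qed.

(** The zero-mean representative of the difference of two classes is a difference
    of representatives, so it differs from [F - x] by a constant almost everywhere. *)
Lemma normE_subE (F x : Omega R d -> R) : F \in Lfun mu 2%:E -> x \in Lfun mu 2%:E ->
  exists c : R, (\int[mu]_g ((F g - x g + c) ^+ 2)%:E =
    ((normE mu (subE (cls mu F) (cls mu x))) ^+ 2)%:E)%E.
Proof.
move=> FL xL; set S := subE _ _; pose z := zero_mean_repr mu S.
have [[a [b [[aL [ca aE]] [bL [cb bE]] zE]]] _] :
    S z /\ (\int[mu]_g (z g)%:E = 0)%E.
  apply: (@xgetPex _ (cst 0) [set y | S y /\ (\int[mu]_g (y g)%:E = 0)%E]).
  have [c c0] := zero_mean_shift (Lfun2_add FL (Lfun2_opp xL)).
  exists (fun g => F g - (x g + c)); split.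
    exists F, (fun g => x g + c); split => //.
      by split => //; exists 0; apply: aeW => g; rewrite addr0.
    split; first exact: Lfun2_add xL (Lfun2_cst c).
    by exists c; exact: aeW.
  by rewrite -[RHS]c0; apply: eq_integral => g _; congr EFin; rewrite opprD addrA.
have zL : z \in Lfun mu 2%:E by rewrite zE; exact: Lfun2_add aL (Lfun2_opp bL).
have /integrableP[mz2 iz2] := Lfun2_integrable_sqr zL.
exists (ca - cb).
have -> : (\int[mu]_g ((F g - x g + (ca - cb)) ^+ 2)%:E = \int[mu]_g (z g ^+ 2)%:E)%E.
  apply: ge0_ae_eq_integral => //.
  - apply/measurable_EFinP; apply: measurable_funX; apply: measurable_funD => //.
    by apply: measurable_funB; exact: Lfun2_measurable.
  - by move=> g _; rewrite lee_fin sqr_ge0.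
  - by move=> g _; rewrite lee_fin sqr_ge0.
  apply: filterS2 aE bE => g /= ag bg _; congr EFin.
  by rewrite zE ag bg; congr (_ ^+ 2); ring.
have i0 : (0 <= \int[mu]_g (z g ^+ 2)%:E)%E.
  by apply: integral_ge0 => g _; rewrite lee_fin sqr_ge0.
have ifin : (\int[mu]_g (z g ^+ 2)%:E)%E \is a fin_num.
  rewrite ge0_fin_numE//; move: iz2; congr (_ < _)%E; apply: eq_integral => g _.
  by rewrite gee0_abs// lee_fin sqr_ge0.
rewrite /normE /innerE -/z /innerL2 /Rintegral sqr_sqrtr; last first.
  by rewrite fine_ge0//; under eq_integral do rewrite -expr2.
by under [in RHS]eq_integral do rewrite -expr2; rewrite fineK.
Qed.
End quotient_norm.

(** * Closability *)
Section constant.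
Local Open Scope ereal_scope.
Context {R : realType} d (T : measurableType d) (nu : probability T R).

Let P : {finite_measure set (T * T)%type -> \bar R} :=
  product_subprobability ((nu : subprobability _ _), (nu : subprobability _ _)).

Lemma integral_proj1 (h : T -> \bar R) : measurable_fun setT h -> (forall g, 0 <= h g) ->
  \int[P]_z h z.1 = \int[nu]_g h g.
Proof.
move=> mh h0.
have mh1 : measurable_fun setT (fun z : (T * T)%type => h z.1).
  exact: (measurableT_comp mh measurable_fst).
transitivity (\int[nu]_g \int[nu]_g' h g).
  exact: (@fubini_tonelli1 _ _ _ _ _ nu nu _ mh1 (fun z => h0 z.1)).
apply: eq_integral => g _; rewrite integral_cst//; set n1 := (X in _ * X).
have -> : n1 = 1 by exact: (probability_setT nu).
by rewrite mule1.
Qed.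

Lemma integral_proj2 (h : T -> \bar R) : measurable_fun setT h -> (forall g, 0 <= h g) ->
  \int[P]_z h z.2 = \int[nu]_g h g.
Proof.
move=> mh h0.
have mh2 : measurable_fun setT (fun z : (T * T)%type => h z.2).
  exact: (measurableT_comp mh measurable_snd).
transitivity (\int[nu]_g' \int[nu]_g h g').
  exact: (@fubini_tonelli2 _ _ _ _ _ nu nu _ mh2 (fun z => h0 z.2)).
apply: eq_integral => g _; rewrite integral_cst//; set n1 := (X in _ * X).
have -> : n1 = 1 by exact: (probability_setT nu).
by rewrite mule1.
Qed.

(** By Tonelli, [x] agrees almost surely with its value at almost every point. *)
Lemma double_diff_const (x : T -> R) : measurable_fun setT x ->
  \int[P]_z `|x z.1 - x z.2|%:E = 0 -> exists c : R, {ae nu, forall g, x g = c}.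
Proof.
move=> mx x0.
pose D (z : (T * T)%type) := `|x z.1 - x z.2|%:E.
have mD : measurable_fun setT D.
  apply/measurable_EFinP; apply: measurableT_comp => //; apply: measurable_funB.
    exact: (measurableT_comp mx measurable_fst).
  exact: (measurableT_comp mx measurable_snd).
have D0 z : 0 <= D z by rewrite lee_fin.
pose G := fubini_F nu D.
have mG : measurable_fun setT G by exact: measurable_fun_fubini_tonelli_F.
have G0 g : 0 <= G g by exact: integral_ge0.
have : \int[nu]_g `|G g| = 0.
  under eq_integral do rewrite gee0_abs//.
  rewrite -[RHS]x0; apply/esym.
  exact: (@fubini_tonelli1 _ _ _ _ _ nu nu _ mD D0).
move=> /(ae_eq_integral_abs nu measurableT mG) [N [mN N0 GN]].
have [g0 Ng0] : exists g0, ~ N g0.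
  apply: contrapT => /forallNP NT.
  have NE : N = setT by apply/seteqP; split => // g _; apply: contrapT; exact: NT.
  have n1 : nu setT = 1 by exact: (probability_setT nu).
  have /eqP := etrans (esym n1) (etrans (congr1 nu (esym NE)) N0).
  by rewrite onee_eq0.
have Gg0 : G g0 = 0.
  by apply: contrapT => h; apply: Ng0; apply: GN => /= /(_ I).
have mDg : measurable_fun setT (fun g => D (g0, g)).
  exact: (measurableT_comp mD (pair1_measurable g0)).
have : \int[nu]_g `|D (g0, g)| = 0.
  by under eq_integral do rewrite gee0_abs//.
move=> /(ae_eq_integral_abs nu measurableT mDg); move=> H; exists (x g0).
apply: filterS H => g /= /(_ I); rewrite /D/= => -[] /eqP.
by rewrite normr_eq0 subr_eq0 => /eqP.
Qed.
End constant.

Theorem proposition3p9 (R : realType) (d : nat)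
    (nu : probability (Omega R d) R) (hnu : is_wiener nu)
    (phi : Omega R d -> \bar R)
    (phi0 : forall g, (0 <= phi g)%E)
    (iphi : nu.-integrable setT phi)
    (hphi : forall F : Omega R d -> R, cylfuns F ->
       nu.-integrable setT (fun g => ((F g)%:E / phi g)%E)) :
  closable (weighted_measure phi0 iphi) (De_inv (weighted_measure phi0 iphi)).
Proof.
set mu := weighted_measure phi0 iphi.
have iV : nu.-integrable setT (fun g => 1%:E / phi g)%E by exact: hphi (cst1_cylfun R d).
have mufin : mu setT \is a fin_num := weighted_fin phi0 iphi.
move=> u X Y uX [x xL ->{Y}] u0 X0.
have mx := Lfun2_measurable xL.
pose P : {finite_measure set (Omega R d * Omega R d)%type -> \bar R} :=
  product_subprobability ((nu : subprobability _ _), (nu : subprobability _ _)).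
pose J := inv_weight_mass nu phi.
have J0 : 0 <= J by exact: inv_weight_mass_ge0.
pose C : R := 4 * Num.sqrt 2.
have C0 : 0 <= C by rewrite mulr_ge0.
(* The gradient term, and twice the approximation term. *)
pose K : R := pi / 2 * (C / 2 + J / 2) + (1 / 2 + J / 2) + (1 / 2 + J / 2).
have K0 : 0 <= K.
  have C2 : 0 <= C / 2 by rewrite divr_ge0.
  have J2 : 0 <= J / 2 by rewrite divr_ge0.
  have pi2 : 0 <= pi / 2 :> R by rewrite divr_ge0// pi_ge0.
  have half0 : 0 <= 1 / 2 :> R by rewrite divr_ge0.
  by apply: addr_ge0; [apply: addr_ge0; [apply: mulr_ge0|]|] => //; exact: addr_ge0.
have mxx : measurable_fun setT
    (fun z : (Omega R d * Omega R d)%type => `|x z.1 - x z.2|%:E).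
  apply/measurable_EFinP; apply: measurableT_comp => //; apply: measurable_funB.
    exact: (measurableT_comp mx measurable_fst).
  exact: (measurableT_comp mx measurable_snd).
have key (e : R) : 0 < e -> (\int[P]_z `|x z.1 - x z.2|%:E <= (e * K)%:E)%E.
  move=> e0.
  (* With both norms below e, the three errors are at most proportional to e. *)
  have [n [un Xn]] : exists n, normL2H mu (u n) < e /\ normE mu (subE (X n) (cls mu x)) < e.
    have /cvgrPdist_lt/(_ e e0) H1 := u0.
    have /cvgrPdist_lt/(_ e e0) H2 := X0.
    have [n [h1 h2]] := filter_ex (filterI H1 H2); exists n.
    rewrite !sub0r !normrN in h1 h2.
    by split; [exact: le_lt_trans (ler_norm _) h1|exact: le_lt_trans (ler_norm _) h2].
  have [F [[k [s [f [hs hf FE uE]]]] FL uL XE]] := uX n.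
  rewrite /= in FE uE uL XE.
  rewrite XE in Xn; rewrite uE in uL un.
  have [c cE] := normE_subE mufin FL xL.
  have mF := Lfun2_measurable FL.
  pose h g := F g - x g + c.
  have mh : measurable_fun setT h.
    by apply: measurable_funD => //; exact: measurable_funB.
  have e2V : (0 <= ((2 * e)^-1)%:E)%E by rewrite lee_fin invr_ge0 mulr_ge0// ltW.
  have eE : e ^+ 2 * (2 * e)^-1 = e * (1 / 2) by field; rewrite gt_eqF.
  have hle : (\int[nu]_g `|h g|%:E <= (e * (1 / 2 + J / 2))%:E)%E.
    apply: (le_trans (L1_le_weighted_L2 phi0 iphi iV mh e0)).
    rewrite mulrDr EFinD; apply: leeD; last by rewrite lee_fin mulrCA.
    rewrite -eE EFinM; apply: lee_wpmul2r => //.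
    rewrite [leLHS]cE lee_fin ler_sqr ?nnegrE ?sqrtr_ge0 ?(ltW e0)//.
    exact: ltW.
  have Hle : (\int[mu]_g (innerH (cylD s f g) (cylD s f g))%:E <= (e ^+ 2)%:E)%E.
    have [_ _ ifin] := uL.
    have i0 : (0 <= \int[mu]_g (innerH (cylD s f g) (cylD s f g))%:E)%E.
      apply: integral_ge0 => g _; rewrite lee_fin (energyE hs uL).
      exact: energy_ge0.
    rewrite -[leLHS]fineK ?ge0_fin_numE// lee_fin.
    rewrite -[leLHS]sqr_sqrtr ?fine_ge0//.
    by rewrite ler_sqr ?nnegrE ?sqrtr_ge0 ?(ltW e0)// ltW.
  have Gle : (\int[P]_z `|F z.1 - F z.2|%:E <= (e * (pi / 2 * (C / 2 + J / 2)))%:E)%E.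
    rewrite FE; apply: (le_trans (cylinder_increment_estimate hnu iV hs hf uL e0)).
    rewrite [X in (_ <= X%:E)%E]mulrCA [leRHS]EFinM; apply: lee_wpmul2l; first by rewrite lee_fin divr_ge0// pi_ge0.
    rewrite [X in (_ <= X%:E)%E]mulrDr [leRHS]EFinD; apply: leeD; last by rewrite lee_fin -/J mulrCA.
    rewrite (_ : e * (C / 2) = C * (e ^+ 2) * (2 * e)^-1)%R; last first.
      by rewrite -mulrA eE; ring.
    rewrite [leRHS]EFinM; apply: lee_wpmul2r => //; rewrite [leRHS]EFinM.
    by apply: lee_wpmul2l.
  have mh1 : measurable_fun setT (fun g => `|h g|%:E).
    by apply/measurable_EFinP; exact: measurableT_comp.
  have mFF : measurable_fun setT
      (fun z : (Omega R d * Omega R d)%type => `|F z.1 - F z.2|%:E).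
    apply/measurable_EFinP; apply: measurableT_comp => //; apply: measurable_funB.
      exact: (measurableT_comp mF measurable_fst).
    exact: (measurableT_comp mF measurable_snd).
  have mhz1 : measurable_fun setT (fun z : (Omega R d * Omega R d)%type => `|h z.1|%:E).
    exact: (measurableT_comp mh1 measurable_fst).
  have mhz2 : measurable_fun setT (fun z : (Omega R d * Omega R d)%type => `|h z.2|%:E).
    exact: (measurableT_comp mh1 measurable_snd).
  apply: (@le_trans _ _ (\int[P]_z (`|F z.1 - F z.2|%:E + `|h z.1|%:E + `|h z.2|%:E))%E).
    apply: ge0_le_integral => //.
    - by apply: emeasurable_funD => //; exact: emeasurable_funD.
    - move=> z _; rewrite -!EFinD lee_fin.
      rewrite (_ : x z.1 - x z.2 = F z.1 - F z.2 - h z.1 + h z.2); last by rewrite /h; ring.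
      rewrite (le_trans (ler_normD _ _))// lerD2r.
      by rewrite (le_trans (ler_normB _ _)).
  rewrite ge0_integralD//; last 2 first.
  - by move=> z _; rewrite adde_ge0// lee_fin.
  - exact: emeasurable_funD.
  rewrite ge0_integralD//.
  rewrite (integral_proj1 nu mh1)// (integral_proj2 nu mh1)//.
  rewrite (_ : e * K = e * (pi / 2 * (C / 2 + J / 2)) + e * (1 / 2 + J / 2) +
    e * (1 / 2 + J / 2)); last by rewrite /K; ring.
  by rewrite !EFinD; apply: leeD => //; apply: leeD.
have xx0 : (\int[P]_z `|x z.1 - x z.2|%:E = 0)%E.
  apply/eqP; rewrite eq_le integral_ge0// andbT.
  apply/lee_addgt0Pr => r r0; rewrite add0e.
  have K1 : 0 < K + 1 by rewrite ltr_wpDl.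
  apply: (le_trans (key (r / (K + 1)) _)); first by rewrite divr_gt0.
  rewrite lee_fin -mulrA mulrC -ler_pdivlMr// divff ?gt_eqF//.
  by rewrite mulrC ler_pdivrMr// mul1r lerDl.
have [c [N [mN N0 xN]]] := double_diff_const mx xx0.
have xc : {ae mu, forall g, x g = c}.
  by exists N; split => //; exact: weighted_dominates.
apply/seteqP; split=> y [yL [b yE]]; split => //.
  exists (c + b); apply: filterS2 yE xc => g /= -> ->; by rewrite add0r.
exists (b - c); apply: filterS2 yE xc => g /= -> ->; rewrite add0r; ring.
Qed.
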